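(* Assume that $f_1,f_2$ satisfy Assumption (A) of the context, and let $(\tilde X_{t_i})_{i=0,\dots,i_{\max}}$ be the Lie–Trotter splitting approximation with time step $\Delta>0$ defined in the context. Then this process has a unique invariant measure $\pi^\Delta$ on $\mathbb{R}^\kappa$. For all initial conditions $x_0$ and all $m\ge1$, there exist $\tilde C=\tilde C(m,\Delta)>0$ and $\tilde\lambda=\tilde\lambda(m,\Delta)>0$ such that, for all measurable functions $g:\mathbb{R}^\kappa\to\mathbb{R}$ such that $|g|\le\tilde G^m$, $$\forall\, i=0,\dots,i_{\max},\qquad\left|\mathbb{E}\,g(\tilde X_{t_i})-\pi^\Delta(g)\right|\le\tilde C\,\tilde G(x_0)^m e^{-\tilde\lambda t_i},$$ where $\pi^\Delta(g)=\int g\,d\pi^\Delta$ and $\tilde G(x)=\sum_{k=1}^2\sum_{j=1}^{\eta_k+1}\frac{j}{\nu_k^{j-1}}|x^{k,j}|$.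
   Context: Parameters: integers $\eta_1,\eta_2\ge1$, reals $\nu_1,\nu_2>0$, $c_1,c_2\in\{-1,+1\}$, $\kappa=\eta_1+\eta_2+2$, an integer $N\ge1$, and $p_1,p_2>0$ with $p_1+p_2=1$. Assumption (A): $f_1,f_2:\mathbb{R}\to\mathbb{R}$ are Lipschitz continuous, non-decreasing, and $0<f_k\le f_k^{\max}<\infty$ for $k=1,2$. A vector $x\in\mathbb{R}^\kappa$ is written $x=(x^1,x^2)$ with $x^k=(x^{k,1},\dots,x^{k,\eta_k+1})\in\mathbb{R}^{\eta_k+1}$. $A\in\mathbb{R}^{\kappa\times\kappa}$ is block-diagonal with blocks $A_{\nu_1},A_{\nu_2}$, where $A_{\nu_k}$ is the $(\eta_k+1)\times(\eta_k+1)$ matrix with $-\nu_k$ on the diagonal, $1$ on the first superdiagonal and $0$ elsewhere. $B:\mathbb{R}^\kappa\to\mathbb{R}^\kappa$ has all components zero except $(B(x))^{1,\eta_1+1}=c_1f_2(x^{2,1})$ and $(B(x))^{2,\eta_2+1}=c_2f_1(x^{1,1})$; $\sigma:\mathbb{R}^\kappa\to\mathbb{R}^{\kappa\times2}$ has all entries zero except the entry in row $(1,\eta_1+1)$, column $2$, equal to $\frac{c_1}{\sqrt{p_2}}\sqrt{f_2(x^{2,1})}$, and the entry in row $(2,\eta_2+1)$, column $1$, equal to $\frac{c_2}{\sqrt{p_1}}\sqrt{f_1(x^{1,1})}$. Lie–Trotter splitting scheme with time step $\Delta>0$ and $t_i=i\Delta$, $i=0,1,\dots,i_{\max}$: $\tilde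 X_{t_0}=x_0\in\mathbb{R}^\kappa$ and $$\tilde X_{t_{i+1}}=e^{A\Delta}\left(\tilde X_{t_i}+\Delta B(\tilde X_{t_i})+\frac{\sqrt\Delta}{\sqrt N}\sigma(\tilde X_{t_i})\xi_i\right),$$ where the $\xi_i=(\xi_i^1,\xi_i^2)^T$ are i.i.d. 2-dimensional standard normal vectors.
   Formalization: The bound fails at x_0 = 0 (take i = 0, g = G̃^m) and no C̃ is uniform as x_0 → 0; it is proved for x_0 ≠ 0 with C̃ depending on x_0, and for all x_0 with uniform C̃ and 1 + G̃(x_0)^m in place of G̃(x_0)^m; m is an integer. *)

(* Defs.v *)
(* MathComp / MathComp-Analysis. *)
From mathcomp Require Export all_boot all_order all_algebra.
From mathcomp Require Export all_classical all_reals all_analysis.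
Export Order.TTheory GRing.Theory Num.Theory.
Export numFieldNormedType.Exports.

Set Implicit Arguments.
Unset Strict Implicit.
Unset Printing Implicit Defensive.

Local Open Scope classical_set_scope.
Local Open Scope ring_scope.

Definition assumption_A (R : realType) (f : R -> R) : Prop :=
  [/\ lipschitz (f : R^o -> R^o),
      {homo f : x y / x <= y} &
      exists fmax : R, forall x, 0 < f x <= fmax].

(* R^n with its Borel sigma-algebra. *)
Notation borel_cV R n := (g_sigma_algebraType (@open 'cV[R]_n)).

Definition expmx (R : realType) (n : nat) (A : 'M[R]_n) : 'M[R]_n :=
  limn (series (fun k => (k`!%:R)^-1 *: A ^+ k)).

(* The splitting scheme. A point x = (x^1, x^2) of R^kappa,
   kappa = eta1 + eta2 + 2, is a column vector of height eta1.+1 + eta2.+1.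
   Indices start at 0: x^{1,j} is x (lshift _ j') 0 and x^{2,j} is
   x (rshift _ j') 0 with j' = j - 1. *)

Definition block1 (R : realType) (eta1 eta2 : nat)
    (x : 'cV[R]_(eta1.+1 + eta2.+1)) (j : 'I_eta1.+1) : R :=
  x (lshift eta2.+1 j) 0.

Definition block2 (R : realType) (eta1 eta2 : nat)
    (x : 'cV[R]_(eta1.+1 + eta2.+1)) (j : 'I_eta2.+1) : R :=
  x (rshift eta1.+1 j) 0.

Definition drift_block (R : realType) (eta : nat) (nu : R) : 'M[R]_eta.+1 :=
  \matrix_(i, j) if i == j then - nu else if j == i.+1 :> nat then 1 else 0.

Definition drift_mx (R : realType) (eta1 eta2 : nat) (nu1 nu2 : R) :
    'M[R]_(eta1.+1 + eta2.+1) :=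
  block_mx (drift_block eta1 nu1) 0 0 (drift_block eta2 nu2).

Definition coupling (R : realType) (eta1 eta2 : nat) (c1 c2 : R)
    (f1 f2 : R -> R) (x : 'cV[R]_(eta1.+1 + eta2.+1)) :
    'cV[R]_(eta1.+1 + eta2.+1) :=
  col_mx
    (\col_(i < eta1.+1) if i == ord_max then c1 * f2 (block2 x ord0) else 0)
    (\col_(i < eta2.+1) if i == ord_max then c2 * f1 (block1 x ord0) else 0).

(* Columns 1 and 2 of sigma have indices 0 and 1. *)
Definition diffusion (R : realType) (eta1 eta2 : nat) (c1 c2 p1 p2 : R)
    (f1 f2 : R -> R) (x : 'cV[R]_(eta1.+1 + eta2.+1)) :
    'M[R]_(eta1.+1 + eta2.+1, 2) :=
  col_mx
    (\matrix_(i < eta1.+1, j < 2)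
       if (i == ord_max) && (j == 1)
       then c1 / Num.sqrt p2 * Num.sqrt (f2 (block2 x ord0)) else 0)
    (\matrix_(i < eta2.+1, j < 2)
       if (i == ord_max) && (j == 0)
       then c2 / Num.sqrt p1 * Num.sqrt (f1 (block1 x ord0)) else 0).

Definition splitting_step (R : realType) (eta1 eta2 : nat)
    (nu1 nu2 c1 c2 p1 p2 : R) (f1 f2 : R -> R) (N : nat) (Delta : R)
    (x : 'cV[R]_(eta1.+1 + eta2.+1)) (xi : 'cV[R]_2) :
    'cV[R]_(eta1.+1 + eta2.+1) :=
  expmx (Delta *: drift_mx eta1 eta2 nu1 nu2) *m
    (x + Delta *: coupling c1 c2 f1 f2 x
       + (Num.sqrt Delta / Num.sqrt N%:R) *:
           (diffusion c1 c2 p1 p2 f1 f2 x *m xi)).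

Definition Gtilde (R : realType) (eta1 eta2 : nat) (nu1 nu2 : R)
    (x : 'cV[R]_(eta1.+1 + eta2.+1)) : R :=
  \sum_(j < eta1.+1) j.+1%:R / nu1 ^+ j * `|block1 x j|
  + \sum_(j < eta2.+1) j.+1%:R / nu2 ^+ j * `|block2 x j|.

(* Two-dimensional noise vectors are pairs, so that their law lives on the
   product sigma-algebra of R * R. *)

Notation noise R := (measurableTypeR R * measurableTypeR R)%type.

Definition noise_vec (R : realType) (z : noise R) : 'cV[R]_2 :=
  \col_(j < 2) if j == 0 then z.1 else z.2.

Definition std_normal2 (R : realType) : set (noise R) -> \bar R :=
  (normal_prob (0 : R) 1 \x normal_prob (0 : R) 1)%E.

Definition mutually_independent (d d' : measure_display)
    (T : measurableType d) (T' : measurableType d') (R : realType)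
    (P : probability T R) (I : finType) (Y : I -> T -> T') : Prop :=
  forall (J : {set I}) (A : I -> set T'), (forall i, measurable (A i)) ->
    P (\bigcap_(i in [set` J]) Y i @^-1` A i)
    = (\prod_(i in J) P (Y i @^-1` A i))%E.

Definition iid_std_normal2 (d : measure_display) (T : measurableType d)
    (R : realType) (P : probability T R) (n : nat)
    (xi : 'I_n -> T -> noise R) : Prop :=
  [/\ forall i, measurable_fun setT (xi i),
      forall i A, measurable A -> P (xi i @^-1` A) = std_normal2 A &
      mutually_independent P xi].

(* X_0 = x0 and X_{i+1} = Phi(X_i, xi_i) for i < n. *)
Definition driven_chain (T : Type) (R : realType) (k n : nat)
    (Phi : 'cV[R]_k -> 'cV[R]_2 -> 'cV[R]_k) (x0 : 'cV[R]_k)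
    (xi : 'I_n -> T -> noise R) (X : nat -> T -> 'cV[R]_k) : Prop :=
  (forall w, X 0 w = x0) /\
  (forall (i : 'I_n) w, X i.+1 w = Phi (X i w) (noise_vec (xi i w))).

(* Law of Phi(x, xi) for xi standard normal: the one-step transition
   probability of the chain. *)
Definition transition (R : realType) (k : nat)
    (Phi : 'cV[R]_k -> 'cV[R]_2 -> 'cV[R]_k) (x : borel_cV R k)
    (A : set (borel_cV R k)) : \bar R :=
  std_normal2 [set z | A (Phi x (noise_vec z))].

Definition invariant_measure (R : realType) (k : nat)
    (Phi : 'cV[R]_k -> 'cV[R]_2 -> 'cV[R]_k)
    (mu : probability (borel_cV R k) R) : Prop :=
  forall A, measurable A -> (\int[mu]_x transition Phi x A)%E = mu A.

(* |E g(X_{t_i}) - mu(g)| <= K exp(- lambda t_i) for every chain started at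
   x0, on any time horizon imax and any probability space, and for every Borel
   g with |g| <= V. The left-hand side is computed in the extended reals, where
   +oo - +oo = -oo, so that the inequality makes both terms finite.
   With V = G^m, a right-hand side K = C * G(x0)^m is impossible at x0 = 0
   (take g = G^m and i = 0), and for x0 <> 0 the constant C cannot be bounded
   as x0 tends to 0; K = C * (1 + G(x0)^m) allows C to be uniform in x0. *)
Definition exponential_bound (R : realType) (k : nat)
    (Phi : 'cV[R]_k -> 'cV[R]_2 -> 'cV[R]_k) (Delta : R)
    (mu : probability (borel_cV R k) R) (V : 'cV[R]_k -> R)
    (x0 : 'cV[R]_k) (K lambda : R) : Prop :=
  forall (imax : nat) (d : measure_display) (T : measurableType d)
         (P : probability T R) (xi : 'I_imax -> T -> noise R)
         (X : nat -> T -> 'cV[R]_k),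
    iid_std_normal2 P xi -> driven_chain Phi x0 xi X ->
  forall g : borel_cV R k -> measurableTypeR R,
    measurable_fun setT g -> (forall x, `|g x| <= V x) ->
  forall i : nat, (i <= imax)%N ->
    (`| 'E_P[fun w => g (X i w)] - \int[mu]_x (g x)%:E |
       <= (K * expR (- lambda * (i%:R * Delta)))%:E)%E.

(* Main.v *)
(** Since e^{A Delta} contracts the weighted l1-norm G by a factor < 1, the
    scheme satisfies E G(X_1)^m <= q G(x)^m + K with q < 1, because the kicks have
    bounded coefficients. The noise only enters the last coordinate of each block,
    but these coordinates propagate through e^{A Delta}: after
    n = eta1 + eta2 + 1 steps, bounded controls steer every point of a sublevel
    set of G to the origin. The standard normal law, shifted and scaled by bounded
    amounts, dominates a multiple of any bounded shift of the uniform law on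
    [0, 1], so the n-step kernel dominates, uniformly on the sublevel set, a
    multiple of one fixed measure. Drift and minorization give a contraction for the
    weight 1 + beta G^m (Hairer and Mattingly's proof of Harris' theorem), hence a limit functional, which is integration against the
    invariant measure. *)

From HB Require Import structures.
From mathcomp Require Import finmap.
Require Import Defs.
From mathcomp Require Import measurable_realfun ring lra.

Set Implicit Arguments.
Unset Strict Implicit.
Unset Printing Implicit Defensive.

Local Open Scope classical_set_scope.
Local Open Scope ring_scope.

(** * Operators of random maps on weighted spaces *)

(** Three obstacles shape the proof. The rates [f1], [f2] may tend to 0 at minus infinity, so the
    noise is bounded below only on sublevel sets of [Gtilde]; the steered path must stay bounded for
    every realization of the common noise, which is why that noise is uniform and clamped. The
    Harris step is phrased for monotone linear operators on functions dominated by a weight, and for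
    pairs of points, rather than for kernels and total variation. The limit measure needs countable
    additivity: iterates at one base point converge at a rate common to all functions with the same
    bound, so dominated convergence passes to the limit. The weights j / nu^(j-1) are what makes
    e^(A Delta) a strict contraction: with s = nu Delta, a weighted column sum is at most e^(-s)
    times a truncated exponential series of s. Each exponent m gives its own application of Harris'
    theorem, and uniqueness among all probability measures, with or without moments, identifies the
    resulting measures. *)

Definition weighted_class d (X : measurableType d) (R : realType) (W : X -> R)
    (h : X -> R) : Prop :=
  measurable_fun setT h /\ exists C : R, forall x, `|h x| <= C * W x.

Section weighted_class_lemmas.
Context d (X : measurableType d) (R : realType) (W : X -> R).
Hypothesis W1 : forall x, 1 <= W x.
Hypothesis mW : measurable_fun setT W.

Lemma weighted_classD h k : weighted_class W h -> weighted_class W k ->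
  weighted_class W (h \+ k).
Proof.
move=> [mh [C hC]] [mk [D kD]]; split; first exact: measurable_funD.
exists (C + D) => x; rewrite mulrDl (le_trans (ler_normD _ _))//.
exact: lerD.
Qed.

Lemma weighted_classZ a h : weighted_class W h ->
  weighted_class W (fun x => a * h x).
Proof.
move=> [mh [C hC]]; split; first exact: measurable_funM.
by exists (`|a| * C) => x; rewrite normrM -mulrA ler_wpM2l.
Qed.

Lemma weighted_class_cst a : weighted_class W (fun=> a).
Proof.
split; first exact: measurable_cst.
by exists `|a| => x; rewrite ler_peMr.
Qed.

Lemma weighted_classB h k : weighted_class W h -> weighted_class W k ->
  weighted_class W (fun x => h x - k x).
Proof.
move=> Wh /(weighted_classZ (-1)) Wk.
have := weighted_classD Wh Wk; congr weighted_class.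
by apply/funext => x /=; rewrite mulN1r.
Qed.

Lemma weighted_class_id : weighted_class W W.
Proof.
split=> //; exists 1 => x; rewrite mul1r ger0_norm//.
exact: le_trans (W1 x).
Qed.

Lemma weighted_class_le C (h : X -> R) : measurable_fun setT h ->
  (forall x, `|h x| <= C * W x) -> weighted_class W h.
Proof. by move=> mh hC; split=> //; exists C. Qed.

Lemma weighted_class_indic A : measurable A -> weighted_class W (\1_A : X -> R).
Proof.
move=> mA; apply: (@weighted_class_le 1); first exact: measurable_indic.
move=> x; rewrite mul1r indicE.
by case: (_ \in _); rewrite ?normr1// normr0 (le_trans _ (W1 x)).
Qed.

Lemma weighted_class_integrable (mu : {measure set X -> \bar R}) h :
  mu.-integrable setT (EFin \o W) -> weighted_class W h ->
  mu.-integrable setT (EFin \o h).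
Proof.
move=> iW [mh [C hC]].
apply: (le_integrable measurableT _ _ (integrableZl measurableT C iW)).
  exact/measurable_EFinP.
move=> x _ /=; rewrite lee_fin (le_trans (hC x))//.
exact: ler_norm.
Qed.

End weighted_class_lemmas.

Section random_map.
Context d d' (X : measurableType d) (Z : measurableType d') (R : realType).
Variables (gamma : probability Z R) (F : X * Z -> X).
Hypothesis mF : measurable_fun setT F.

(** [Rintegral] is 0 on an infinite integral, hence linearity and monotonicity are asserted below
    only on [weighted_class W]. *)
Definition avg (h : X -> R) (x : X) : R := \int[gamma]_z h (F (x, z)).

Let mFx x : measurable_fun setT (fun z => F (x, z)).
Proof. exact: measurableT_comp mF (pair1_measurable x). Qed.

(** Tonelli gives measurability of partial integrals of nonnegative functions, so the integral is
    split into its positive and negative parts. *)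
Lemma measurable_avg h : measurable_fun setT h -> measurable_fun setT (avg h).
Proof.
move=> mh; rewrite /avg /Rintegral.
apply: (measurableT_comp (fine_measurable _)) => //.
under eq_fun do rewrite integralE.
have mhF : measurable_fun setT (fun p : X * Z => (h (F p))%:E).
  by apply/measurable_EFinP; exact: measurableT_comp.
apply: emeasurable_funB.
- have := measurable_fun_fubini_tonelli_F (m2 := gamma) _
    (measurable_funepos mhF) (fun=> funepos_ge0 _ _).
  congr measurable_fun; apply/funext => x; apply: eq_integral => z _ /=.
  by rewrite !funeposE.
- have := measurable_fun_fubini_tonelli_F (m2 := gamma) _
    (measurable_funeneg mhF) (fun=> funeneg_ge0 _ _).
  congr measurable_fun; apply/funext => x; apply: eq_integral => z _ /=.
  by rewrite !funenegE.
Qed.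

Variable W : X -> R.
Hypothesis W1 : forall x, 1 <= W x.
Hypothesis mW : measurable_fun setT W.
Variable c : R.
Hypothesis Wc : forall x, (\int[gamma]_z (W (F (x, z)))%:E <= (c * W x)%:E)%E.

Let W0 x : 0 <= W x. Proof. exact: le_trans (W1 x). Qed.

Lemma avg_integrable h x : weighted_class W h ->
  gamma.-integrable setT (fun z => (h (F (x, z)))%:E).
Proof.
move=> [mh [C hC]].
have iW : gamma.-integrable setT (fun z => (W (F (x, z)))%:E).
  apply/integrableP; split.
    by apply/measurable_EFinP; exact: measurableT_comp mW (mFx x).
  under eq_integral do rewrite gee0_abs ?lee_fin//.
  exact: le_lt_trans (Wc x) (ltry _).
apply: (le_integrable measurableT _ _ (integrableZl measurableT C iW)).
  by apply/measurable_EFinP; exact: measurableT_comp mh (mFx x).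
move=> z _ /=; rewrite lee_fin (le_trans (hC _))//.
exact: ler_norm.
Qed.

Lemma EFin_avg h x : weighted_class W h ->
  (avg h x)%:E = (\int[gamma]_z (h (F (x, z)))%:E)%E.
Proof.
move=> Wh; rewrite /avg /Rintegral fineK//.
exact: (integrable_fin_num measurableT (avg_integrable x Wh)).
Qed.

Lemma le_avg h k x : weighted_class W h -> weighted_class W k ->
  (forall y, h y <= k y) -> avg h x <= avg k x.
Proof.
move=> Wh Wk hk; apply: le_Rintegral => //; try exact: avg_integrable.
Qed.

Lemma avg_cst a x : avg (fun=> a) x = a.
Proof.
rewrite /avg Rintegral_cst//.
by move: (@probability_setT _ _ _ gamma) => /= ->; rewrite mulr1.
Qed.

Lemma avgZ a h x : weighted_class W h ->
  avg (fun y => a * h y) x = a * avg h x.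
Proof. by move=> Wh; rewrite /avg RintegralZl//; exact: avg_integrable. Qed.

Lemma avgB h k x : weighted_class W h -> weighted_class W k ->
  avg (fun y => h y - k y) x = avg h x - avg k x.
Proof. by move=> Wh Wk; rewrite /avg RintegralB//; exact: avg_integrable. Qed.

Lemma avg_weighted h : weighted_class W h -> weighted_class W (avg h).
Proof.
move=> Wh; have [mh [C hC]] := Wh; split; first exact: measurable_avg.
exists (`|C| * c) => x.
have Wn : weighted_class W (fun y => `|C| * W y).
  exact/weighted_classZ/weighted_class_id.
have hn y : `|h y| <= `|C| * W y.
  by rewrite (le_trans (hC y))// ler_wpM2r// ler_norm.
have -> : `|C| * c * W x = `|C| * (c * W x) by rewrite mulrA.
apply: (@le_trans _ _ (`|C| * avg W x)); last first.
  rewrite ler_wpM2l// -lee_fin EFin_avg//; exact: weighted_class_id.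
rewrite -avgZ; last exact: weighted_class_id.
rewrite ler_norml; apply/andP; split; last first.
  by apply: le_avg => // y; rewrite (le_trans (ler_norm _)).
rewrite lerNl -mulN1r -avgZ//; apply: le_avg => //.
  exact: weighted_classZ.
by move=> y; rewrite mulN1r (le_trans _ (hn y))// -normrN ler_norm.
Qed.

Lemma iter_avg_weighted n h : weighted_class W h ->
  weighted_class W (iter n avg h).
Proof. by move=> Wh; elim: n => //= n IH; exact: avg_weighted. Qed.

End random_map.

Section push_measure.
Context d d' (X : measurableType d) (Z : measurableType d') (R : realType).
Variables (gamma : probability Z R) (F : X * Z -> X).
Hypothesis mF : measurable_fun setT F.
Let F_mfun : {mfun (X * Z)%type >-> X} := HB.pack F (isMeasurableFun.Build _ _ _ _ F mF).

Definition push (mu : probability X R) : probability X R :=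
  distribution (mu \x gamma)%E F_mfun.

Lemma pushE mu A : push mu A = (\int[mu]_x gamma [set z | A (F (x, z))])%E.
Proof.
rewrite /push /distribution /pushforward /= /product_measure1.
by apply: eq_integral => x _ /=; congr (gamma _); apply/seteqP; split=> z /=;
  rewrite /xsection /= inE.
Qed.

Variable W : X -> R.
Hypothesis W1 : forall x, 1 <= W x.
Hypothesis mW : measurable_fun setT W.
Variable c : R.
Hypothesis Wc : forall x, (\int[gamma]_z (W (F (x, z)))%:E <= (c * W x)%:E)%E.

Let W0 x : 0 <= W x. Proof. exact: le_trans (W1 x). Qed.

Section one_step.
Variable mu : probability X R.
Hypothesis iW : mu.-integrable setT (EFin \o W).

Let iWF : (mu \x gamma)%E.-integrable setT (fun p => (W (F p))%:E).
Proof.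
apply/integrable12ltyP.
  by apply/measurable_EFinP; exact: measurableT_comp.
have mWF : measurable_fun setT (fun p : X * Z => (W (F p))%:E).
  by apply/measurable_EFinP; exact: measurableT_comp.
apply: (@le_lt_trans _ _ (\int[mu]_x (`|c|%:E * (W x)%:E))%E); last first.
  by rewrite integralZl// -(fineK (integrable_fin_num measurableT iW)) -EFinM ltry.
apply: ge0_le_integral => //.
- by move=> x _; exact: integral_ge0.
- have := measurable_fun_fubini_tonelli_F (m2 := gamma) _ mWF.
  rewrite (_ : fubini_F _ _ = fun x => \int[gamma]_z `|(W (F (x, z)))%:E|)%E.
    by apply => p; rewrite lee_fin.
  by apply/funext => x; apply: eq_integral => z _; rewrite gee0_abs ?lee_fin.
- apply: measurable_funeM; exact/measurable_EFinP.
- move=> x _; under eq_integral do rewrite gee0_abs ?lee_fin//.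
  by rewrite (le_trans (Wc x))// -EFinM lee_fin ler_wpM2r// ler_norm.
Qed.

Lemma integrable_push : (push mu).-integrable setT (EFin \o W).
Proof.
apply: (@integrable_pushforward _ _ _ _ _ F mF (mu \x gamma)%E) => //.
exact/measurable_EFinP.
Qed.

(** Duality between [push] on measures and [avg] on functions: transport along [F], then Fubini,
    licensed by the integrability of [W] along [F]. *)
Lemma integral_push h : weighted_class W h ->
  (\int[push mu]_x (h x)%:E = \int[mu]_x (avg gamma F h x)%:E)%E.
Proof.
move=> Wh; have [mh [C hC]] := Wh.
have ihF : (mu \x gamma)%E.-integrable setT (fun p => (h (F p))%:E).
  apply: (le_integrable measurableT _ _ (integrableZl measurableT C iWF)).
    by apply/measurable_EFinP; exact: measurableT_comp.
  by move=> p _ /=; rewrite lee_fin (le_trans (hC _))// ler_norm.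
rewrite (@integral_pushforward _ _ _ _ _ F mF (mu \x gamma)%E)//; last first.
  exact/measurable_EFinP.
rewrite preimage_setT -integral12_prod_meas1//.
by apply: eq_integral => x _; rewrite (EFin_avg mF W1 mW Wc _ Wh).
Qed.

End one_step.

Fixpoint law n (x : X) : probability X R :=
  if n is n'.+1 then push (law n' x) else \d_x.

Lemma law_integrable n x : (law n x).-integrable setT (EFin \o W).
Proof.
elim: n => [|n IH] /=; last exact: integrable_push.
apply/integrableP; split; first exact/measurable_EFinP.
rewrite integral_dirac//=; last first.
  by apply/measurable_EFinP; exact: measurableT_comp.
by rewrite diracT mul1e ltry.
Qed.

(** Peeling off the last [push] replaces [h] by its average, so the induction must range over all
    [h]; the new average ends up innermost. *)
Lemma integral_law n x h : weighted_class W h ->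
  (\int[law n x]_y (h y)%:E = (iter n (avg gamma F) h x)%:E)%E.
Proof.
elim: n h => [|n IH] h Wh /=.
  rewrite integral_dirac//=; last by apply/measurable_EFinP; case: Wh.
  by rewrite diracT mul1e.
rewrite integral_push//; last exact: law_integrable.
rewrite IH; last exact: (avg_weighted mF W1 mW Wc).
by rewrite -iterSr.
Qed.

Lemma law_indic n x A : measurable A ->
  (law n x A = (iter n (avg gamma F) (\1_A) x)%:E)%E.
Proof.
move=> mA; rewrite -integral_law; last exact: weighted_class_indic.
by rewrite integral_indic// setIT.
Qed.

End push_measure.

(** * Harris' theorem for Markov operators *)

Section harris.
Context (X : Type) (R : realType) (D : (X -> R) -> Prop).

(** The contraction argument sees an operator only through these algebraic properties, which pass to
    its iterates. *)
Definition markov_operator (Q : (X -> R) -> X -> R) : Prop :=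
  [/\ forall h, D h -> D (Q h),
      forall h k x, D h -> D k -> Q (fun y => h y - k y) x = Q h x - Q k x,
      forall a h x, D h -> Q (fun y => a * h y) x = a * Q h x,
      forall a x, Q (fun=> a) x = a &
      forall h k x, D h -> D k -> (forall y, h y <= k y) -> Q h x <= Q k x].

Hypothesis DB : forall h k, D h -> D k -> D (fun x => h x - k x).
Hypothesis DZ : forall a h, D h -> D (fun x => a * h x).
Hypothesis Dcst : forall a, D (fun=> a).

Lemma markov_operator_iter n Q :
  markov_operator Q -> markov_operator (iter n Q).
Proof.
move=> [QD QB QZ Qc Qle]; elim: n => [|n [ID IB IZ Ic Ile]]; first by split.
split=> /=.
- by move=> h /ID /QD.
- move=> h k x Dh Dk; rewrite -QB; [|exact: ID..].
  by congr (Q _ x); apply/funext => y; rewrite IB.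
- move=> a h x Dh; rewrite -QZ; last exact: ID.
  by congr (Q _ x); apply/funext => y; rewrite IZ.
- move=> a x; rewrite -[RHS](Qc a x); congr (Q _ x).
  by apply/funext => y; rewrite Ic.
- move=> h k x Dh Dk hk; apply: Qle; [exact: ID..|].
  by move=> y; exact: Ile.
Qed.

Lemma DD h k : D h -> D k -> D (fun x => h x + k x).
Proof.
move=> Dh Dk; have := DB Dh (DZ (-1) Dk); congr D.
by apply/funext => x; rewrite mulN1r opprK.
Qed.

Section operator.
Variable Q : (X -> R) -> X -> R.
Hypothesis mQ : markov_operator Q.

Lemma markov_operatorD h k x : D h -> D k ->
  Q (fun y => h y + k y) x = Q h x + Q k x.
Proof.
move=> Dh Dk; have [_ QB QZ _ _] := mQ.
rewrite (_ : (fun y => _) = fun y => h y - (-1) * k y); last first.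
  by apply/funext => y; rewrite mulN1r opprK.
by rewrite QB//; [rewrite QZ// mulN1r opprK|exact: DZ].
Qed.

End operator.

(** [K / (1 - gam)] is the fixed point of c |-> gam c + K, so it absorbs the additive error of every
    step. *)
Lemma markov_operator_drift Q (V : X -> R) (gam K : R) n : markov_operator Q ->
  0 <= gam -> gam < 1 -> 0 <= K -> D V -> (forall x, Q V x <= gam * V x + K) ->
  forall x, iter n Q V x <= gam ^+ n * V x + K / (1 - gam).
Proof.
move=> mQ g0 g1 K0 DV QV; have g1' : 0 < 1 - gam by rewrite subr_gt0.
elim: n => [|n IH] x.
  by rewrite expr0 mul1r lerDl divr_ge0// ltW.
have [ID _ IZ Ic Ile] := markov_operator_iter n mQ.
rewrite iterSr.
apply: (@le_trans _ _ (iter n Q (fun y => gam * V y + K) x)).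
  apply: Ile => //; first by case: mQ => + _ _ _ _; exact.
  by apply: DD; [exact: DZ|exact: Dcst].
rewrite (markov_operatorD (markov_operator_iter n mQ)); [|exact: DZ|exact: Dcst].
rewrite IZ// Ic.
have -> : gam ^+ n.+1 * V x + K / (1 - gam) =
    gam * (gam ^+ n * V x + K / (1 - gam)) + K.
  by rewrite exprS; field; rewrite gt_eqF.
by rewrite lerD2r ler_wpM2l.
Qed.

Section contraction.
Variables (Q : (X -> R) -> X -> R) (V : X -> R) (gam K : R).
Hypothesis mQ : markov_operator Q.
Hypotheses (g0 : 0 <= gam) (g1 : gam < 1) (K0 : 0 <= K).
Hypotheses (DV : D V) (V0 : forall x, 0 <= V x).
Hypothesis drift : forall x, Q V x <= gam * V x + K.

(* Two-point form of the minorization condition [Q(x, .) >= a nu] for all [x]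
   in the sublevel set: it makes no reference to the measure [nu]. *)
Definition minorization (Q : (X -> R) -> X -> R) : Prop :=
  forall r : R, exists2 a : R, 0 < a & forall (b : R) u v x y, V x + V y <= r ->
    D u -> D v -> (forall z, 0 <= u z) -> (forall z, 0 <= v z) ->
    0 <= b -> (forall z, b <= u z + v z) -> a * b <= Q u x + Q v y.

Hypothesis minor : minorization Q.

(** With W = 1 + beta V, the hypothesis on [phi] reads phi x - phi y <= M (W x + W y), which is
    equivalent to |phi - c| <= M W for some constant c. Thus [u] = M W - (phi - c) and [v] = M W +
    (phi - c) are nonnegative, and Q phi x - Q phi y = M (Q W x + Q W y) - (Q u x + Q v y). Drift
    bounds the first term; minorization makes the second one large when V x + V y is small. *)
Lemma weighted_oscillation_contraction : exists2 beta : R, 0 < beta &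
  exists2 alpha : R, 0 < alpha < 1 & forall (M : R) phi, 0 <= M -> D phi ->
    (forall x y, phi x - phi y <= M * (2 + beta * (V x + V y))) ->
    forall x y, Q phi x - Q phi y <= alpha * M * (2 + beta * (V x + V y)).
Proof.
have [g0' K0'] := (g0, K0).
have g1' : 0 < 1 - gam by rewrite subr_gt0.
(* Beyond this level S = V x + V y satisfies (1 - gam) S / 2 >= 2 K + 2, which beats the two drift
   constants by a margin of 2. *)
have [a a0 Ha] := minor ((4 * K + 4) / (1 - gam)).
(* Small enough that the error 2 beta K stays below the gain 2 a of minorization, with margin a +
   beta; the + 1 keeps the denominator positive when K = 0. *)
pose beta : R := a / (2 * K + 1).
have K1 : 0 < 2 * K + 1 by rewrite ltr_wpDl// mulr_ge0.
have b0 : 0 < beta by rewrite divr_gt0.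
have bK : beta * (2 * K + 1) = a by rewrite /beta mulfVK// gt_eqF.
(* The entries are the rate on beta (V x + V y) in both cases, then the rates on the constant 2 for
   small and for large V x + V y. *)
pose alpha := Num.max ((1 + gam) / 2) (Num.max (1 - a / 2) (1 - beta)).
have al1 : (1 + gam) / 2 <= alpha by rewrite le_max lexx.
have al2 : 1 - a / 2 <= alpha by rewrite !le_max lexx orbT.
have al3 : 1 - beta <= alpha by rewrite !le_max lexx !orbT.
have al4 : alpha < 1 by rewrite !gt_max; apply/and3P; split; lra.
exists beta => //; exists alpha.
  apply/andP; split=> //.
  by lra.
move=> M phi M0 Dphi osc x y.
have [QD QB QZ Qc Qle] := mQ.
pose W z := 1 + beta * V z.
have DW : D W by apply: DD => //; exact: DZ.
have QW z : Q W z <= 1 + beta * (gam * V z + K).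
  rewrite /W markov_operatorD//; last exact: DZ.
  by rewrite Qc QZ// lerD2l ler_pM2l.
(* [c] is the supremum of phi - M W; by the oscillation hypothesis every phi z + M W z is an upper
   bound of that set. *)
have [c cle cge] : exists2 c, (forall z, phi z - M * W z <= c) &
    (forall z, c <= phi z + M * W z).
  pose E := range (fun z => phi z - M * W z).
  have Eub z : ubound E (phi z + M * W z).
    move=> _ [t _ <-]; rewrite /W.
    by have := osc t z; lra.
  exists (sup E) => z.
    by apply: ub_le_sup; [exists (phi x + M * W x); exact: Eub|exists z].
  by apply: ge_sup; [exists (phi x - M * W x); exists x|exact: Eub].
pose u z := M * W z - (phi z - c); pose v z := M * W z + (phi z - c).
have Dp : D (fun z => phi z - c) by exact: DB.
have Du : D u by apply: DB => //; exact: DZ.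
have Dv : D v by apply: DD => //; exact: DZ.
have u0 z : 0 <= u z by rewrite /u; have := cle z; lra.
have v0 z : 0 <= v z by rewrite /v; have := cge z; lra.
have Qu : Q u x = M * Q W x - (Q phi x - c).
  rewrite /u QB//; last exact: DZ.
  by rewrite QZ// QB// Qc.
have Qv : Q v y = M * Q W y + (Q phi y - c).
  rewrite /v markov_operatorD//; last exact: DZ.
  by rewrite QZ// QB// Qc.
have W1 z : 1 <= W z by rewrite /W lerDl mulr_ge0// ltW.
have uv z : M * 2 <= u z + v z.
  rewrite /u /v; have : M * 1 <= M * W z by rewrite ler_wpM2l.
  by lra.
have QWM z : M * Q W z <= M * (1 + beta * (gam * V z + K)) by rewrite ler_wpM2l.
rewrite -mulrA mulrCA; set S := V x + V y.
have S0 : 0 <= S by rewrite addr_ge0.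
have bS0 : 0 <= beta * S by rewrite mulr_ge0// ltW.
(* For small S, minorization is used with b = 2 M, as u + v = 2 M W >= 2 M. For large S, only Q u x
   + Q v y >= 0 enters. *)
have [Sr|rS] := leP S ((4 * K + 4) / (1 - gam)).
  have := Ha (M * 2) u v x y Sr Du Dv u0 v0 _ uv.
  rewrite mulr_ge0// => /(_ isT) h.
  apply: (@le_trans _ _ (M * (2 + beta * (gam * S + 2 * K) - a * 2))).
    rewrite Qu Qv in h; have := QWM x; have := QWM y; rewrite /S; lra.
  rewrite ler_wpM2l//.
  have h1 : beta * S * gam <= beta * S * alpha.
    by rewrite ler_wpM2l//; lra.
  by lra.
have h : 0 <= Q u x + Q v y.
  have Q0 h z : D h -> (forall t, 0 <= h t) -> 0 <= Q h z.
    by move=> Dh h0; rewrite -[leLHS](Qc 0 z); exact: Qle.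
  by rewrite addr_ge0// Q0.
apply: (@le_trans _ _ (M * (2 + beta * (gam * S + 2 * K)))).
  rewrite Qu Qv in h; have := QWM x; have := QWM y; rewrite /S; lra.
rewrite ler_wpM2l//.
have h1 : beta * S * ((1 + gam) / 2) <= beta * S * alpha.
  by rewrite ler_wpM2l//; lra.
rewrite ltr_pdivrMr// in rS.
have h2 : beta * (4 * K + 4) <= beta * (S * (1 - gam)) by rewrite ler_pM2l// ltW.
by lra.
Qed.

End contraction.

(** Minorization holds for the n-step operator. Writing i = k n + r, the contraction acts k times on
    [iter r P phi], whose oscillation is controlled by drift alone. *)
Theorem harris_contraction (P : (X -> R) -> X -> R) (V : X -> R) (gam K : R)
    (n : nat) :
  markov_operator P -> 0 <= gam -> gam < 1 -> 0 <= K ->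
  D V -> (forall x, 0 <= V x) -> (forall x, P V x <= gam * V x + K) ->
  (0 < n)%N -> minorization V (iter n P) ->
  exists2 C : R, 0 <= C & exists2 rho : R, 0 < rho < 1 &
    forall phi, D phi -> (forall x, `|phi x| <= 1 + V x) ->
    forall i x y, `|iter i P phi x - iter i P phi y| <=
      C * rho ^+ i * (2 + (V x + V y)).
Proof.
move=> mP g0 g1 K0 DV V0 drift n0 minor.
have g1' : 0 < 1 - gam by rewrite subr_gt0.
pose K' := K / (1 - gam).
have K'0 : 0 <= K' by rewrite divr_ge0// ltW.
have driftn k x : iter k P V x <= gam ^+ k * V x + K'.
  exact: (markov_operator_drift k mP).
have Qdrift x : iter n P V x <= gam * V x + K'.
  rewrite (le_trans (driftn n x))// lerD2r ler_wpM2r//.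
  by rewrite -(prednK n0) exprS ler_piMr// exprn_ile1// ltW.
have [beta b0 [al /andP[al0 al1] contr]] :=
  weighted_oscillation_contraction (markov_operator_iter n mP) g0 g1 K'0 DV V0
    Qdrift minor.
(* The n-th root of [al]; dividing the final constant by [al] pays for the incomplete block of fewer
   than n steps. *)
pose rho := expR (ln al / n%:R).
have rhon : rho ^+ n = al.
  rewrite -expRM_natl -mulrC mulrVK ?unitfE ?pnatr_eq0 ?gtn_eqF// lnK//.
have rho0 : 0 < rho by exact: expR_gt0.
have rho1 : rho < 1.
  by rewrite expR_lt1 pmulr_llt0 ?invr_gt0 ?ltr0n// ln_lt0// al0.
have b0' : 0 < beta^-1 by rewrite invr_gt0.
(* The factor 1 + K' comes from the drift over the remaining steps, the factor 1 + 1 / beta from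
   passing from the weight V to beta V. *)
pose M := (1 + K') * (1 + beta^-1).
have M0 : 0 <= M by rewrite mulr_ge0// addr_ge0// ltW.
exists (M * (1 + beta) / al).
  by rewrite divr_ge0 ?(ltW al0)// mulr_ge0// addr_ge0// ltW.
exists rho; first by rewrite rho0.
move=> phi Dphi phiV i.
suff H x y : iter i P phi x - iter i P phi y <=
    M * (1 + beta) / al * rho ^+ i * (2 + (V x + V y)).
  move=> x y; rewrite ler_norml H andbT lerNl opprB.
  by rewrite [V x + V y]addrC H.
pose r := (i %% n)%N; pose k := (i %/ n)%N.
have [ID IB IZ Ic Ile] := markov_operator_iter r mP.
have Vr z : iter r P V z <= V z + K'.
  rewrite (le_trans (driftn r z))// lerD2r ler_piMl//.
  by rewrite exprn_ile1// ltW.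
have psi_osc z t : iter r P phi z - iter r P phi t <=
    M * (2 + beta * (V z + V t)).
  have D1V : D (fun y => 1 + V y) by exact: DD.
  have up s : iter r P phi s <= 1 + (V s + K').
    apply: (@le_trans _ _ (iter r P (fun y => 1 + V y) s)).
      by apply: Ile => // ?; rewrite (le_trans (ler_norm _)).
    rewrite (markov_operatorD (markov_operator_iter r mP))// Ic lerD2l.
    exact: Vr.
  have lo s : - iter r P phi s <= 1 + (V s + K').
    apply: (@le_trans _ _ (iter r P (fun y => 1 + V y) s)).
      rewrite -mulN1r -IZ//; apply: Ile => //; first exact: DZ.
      by move=> ?; rewrite mulN1r (le_trans _ (phiV _))// -normrN ler_norm.
    rewrite (markov_operatorD (markov_operator_iter r mP))// Ic lerD2l.
    exact: Vr.
  have bb : beta^-1 * beta = 1 by rewrite mulVf// gt_eqF.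
  have S0 : 0 <= V z + V t by rewrite addr_ge0.
  apply: (@le_trans _ _ ((1 + K') * (2 + (V z + V t)))).
    have := up z; have := lo t.
    have : 0 <= K' * (V z + V t) by rewrite mulr_ge0.
    by lra.
  rewrite -mulrA ler_wpM2l ?addr_ge0//.
  have : 0 <= beta * (V z + V t) by rewrite mulr_ge0// ltW.
  have -> : (1 + beta^-1) * (2 + beta * (V z + V t)) =
    2 + beta * (V z + V t) + 2 * beta^-1 + beta^-1 * beta * (V z + V t) by ring.
  by rewrite bb; lra.
have kth : forall x y, iter k (iter n P) (iter r P phi) x -
    iter k (iter n P) (iter r P phi) y <= al ^+ k * M * (2 + beta * (V x + V y)).
  elim: k => [|k IH] {}x {}y.
    by rewrite expr0 mul1r; exact: psi_osc.
  have [JD _ _ _ _] := markov_operator_iter k (markov_operator_iter n mP).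
  rewrite exprS -(mulrA al) /=; apply: contr => //.
    by rewrite mulr_ge0// exprn_ge0// ltW.
  exact/JD/ID.
have iE : iter i P phi = iter k (iter n P) (iter r P phi).
  rewrite {1}(divn_eq i n) -/k -/r iterD; elim: k {kth} => //= k IH.
  by rewrite mulSn iterD IH.
rewrite iE; apply: (le_trans (kth x y)).
have -> : M * (1 + beta) / al * rho ^+ i * (2 + (V x + V y)) =
  M * ((rho ^+ i / al) * ((1 + beta) * (2 + (V x + V y)))) by ring.
rewrite mulrAC mulrC ler_wpM2l//.
have S0 : 0 <= V x + V y by rewrite addr_ge0.
apply: ler_pM.
- by rewrite exprn_ge0// ltW.
- by rewrite addr_ge0// mulr_ge0// ltW.
- rewrite ler_pdivlMr// -rhon -exprM -exprD /k.
  apply: ler_wiXn2l; [exact: ltW|exact: ltW|].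
  by rewrite [leqLHS](divn_eq i n) mulnC leq_add2l ltnW// ltn_mod.
- have : 0 <= beta * (V x + V y) by rewrite mulr_ge0// ltW.
  by lra.
Qed.

End harris.

(** * Limit measures *)

Lemma avg_markov d d' (X : measurableType d) (Z : measurableType d')
    (R : realType) (gamma : probability Z R) (F : X * Z -> X) (W : X -> R)
    (c : R) :
  measurable_fun setT F -> (forall x, 1 <= W x) -> measurable_fun setT W ->
  (forall x, (\int[gamma]_z (W (F (x, z)))%:E <= (c * W x)%:E)%E) ->
  markov_operator (weighted_class W) (avg gamma F).
Proof.
move=> mF W1 mW Wc; split.
- by move=> h; exact: (avg_weighted mF W1 mW Wc).
- by move=> h k x; exact: (avgB mF W1 mW Wc).
- by move=> a h x; exact: (avgZ mF W1 mW Wc).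
- by move=> a x; exact: avg_cst.
- by move=> h k x; exact: (le_avg mF W1 mW Wc).
Qed.

Lemma cvg_rate (R : realType) (u v : R^nat) (l : R) : (forall i, `|u i - l| <= v i) ->
  v i @[i --> \oo] --> 0 -> u i @[i --> \oo] --> l.
Proof.
move=> uv v0; apply: (@squeeze_cvgr _ _ _ _ (fun i => l - v i) (fun i => l + v i)).
- by apply: nearW => i; have := uv i; rewrite ler_distl.
- by rewrite -[X in _ --> X]subr0; apply: cvgB => //; exact: cvg_cst.
- by rewrite -[X in _ --> X]addr0; apply: cvgD => //; exact: cvg_cst.
Qed.

Section invariant_measure_of_contraction.
Context d d' (X : measurableType d) (Z : measurableType d') (R : realType).
Variables (gamma : probability Z R) (F : X * Z -> X).
Hypothesis mF : measurable_fun setT F.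
Variable W : X -> R.
Hypothesis W1 : forall x, 1 <= W x.
Hypothesis mW : measurable_fun setT W.
Variable c : R.
Hypothesis Wc : forall x, (\int[gamma]_z (W (F (x, z)))%:E <= (c * W x)%:E)%E.

Local Notation P := (avg gamma F).
Local Notation dom := (weighted_class W).

Variables (B : R) (C rho : R).
Hypothesis PWB : forall n x, iter n P W x <= W x + B.
Hypotheses (C0 : 0 <= C) (rho01 : 0 < rho < 1).
Hypothesis contr : forall phi, dom phi -> (forall x, `|phi x| <= W x) ->
  forall i x y, `|iter i P phi x - iter i P phi y| <= C * rho ^+ i * (W x + W y).
Variable x0 : X.

Let rho0 : 0 <= rho. Proof. by case/andP: rho01 => /ltW. Qed.
Let W0 x : 0 <= W x. Proof. exact: le_trans (W1 x). Qed.
Let dW : dom W. Proof. exact: weighted_class_id. Qed.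
(** For |h| <= W, this bounds the variation of [iter i P h x0] after time i: the contraction factor
    times W x0 + iter j P W x0 <= 2 W x0 + B. *)
Let e i := C * rho ^+ i * (2 * W x0 + B).
Let B0 : 0 <= B.
Proof. by have := PWB 0 x0; rewrite /= lerDl. Qed.
Let e0 i : 0 <= e i.
Proof.
by rewrite mulr_ge0// ?addr_ge0// mulr_ge0// exprn_ge0.
Qed.

Let mP : markov_operator dom P.
Proof. exact: (avg_markov mF W1 mW Wc). Qed.

Let mPn n : markov_operator dom (iter n P).
Proof.
exact: markov_operator_iter.
Qed.

Let iter_dom n h : dom h -> dom (iter n P h).
Proof. by have [+ _ _ _ _] := mPn n; exact. Qed.

Let iter_B n h k x : dom h -> dom k ->
  iter n P (fun y => h y - k y) x = iter n P h x - iter n P k x.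
Proof. by have [_ + _ _ _] := mPn n; exact. Qed.

Let iter_Z n a h x : dom h -> iter n P (fun y => a * h y) x = a * iter n P h x.
Proof. by have [_ _ + _ _] := mPn n; exact. Qed.

Let iter_cst n a x : iter n P (fun=> a) x = a.
Proof. by have [_ _ _ + _] := mPn n; exact. Qed.

Let iter_le n h k x : dom h -> dom k -> (forall y, h y <= k y) ->
  iter n P h x <= iter n P k x.
Proof. by have [_ _ _ _ +] := mPn n; exact. Qed.

Let iter_D n h k x : dom h -> dom k ->
  iter n P (fun y => h y + k y) x = iter n P h x + iter n P k x.
Proof.
move=> dh dk; apply: (markov_operatorD _ (mPn n)) => //.
by move=> *; exact: weighted_classZ.
Qed.

Let iter_norm n h k x : dom h -> dom k -> (forall y, `|h y| <= k y) ->
  `|iter n P h x| <= iter n P k x.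
Proof.
move=> dh dk hk; rewrite ler_norml; apply/andP; split.
  rewrite -mulN1r -iter_Z//; apply: iter_le => //; first exact: weighted_classZ.
  by move=> y; have := hk y; rewrite ler_norml mulN1r => /andP[].
by apply: iter_le => // y; rewrite (le_trans (ler_norm _)).
Qed.

Let contr_scaled h M : dom h -> (forall x, `|h x| <= M * W x) ->
  forall i x y, `|iter i P h x - iter i P h y| <=
    M * (C * rho ^+ i * (W x + W y)).
Proof.
move=> dh hM i x y.
have M0 : 0 <= M.
  have := le_trans (normr_ge0 _) (hM x0).
  by rewrite pmulr_lge0// (lt_le_trans _ (W1 x0)).
(* [contr] is applied to h / M, so the case M = 0, where h vanishes, is treated apart. *)
have [M00|M0'] := eqVneq M 0.
  have -> : h = fun=> 0.
    apply/funext => z; apply/eqP; rewrite -normr_le0.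
    by rewrite (le_trans (hM z))// M00 mul0r.
  by rewrite !iter_cst subrr normr0 M00 mul0r.
have Mp : 0 < M by rewrite lt_def M0' M0.
have := @contr (fun z => M^-1 * h z) (weighted_classZ _ dh) _ i x y.
rewrite !iter_Z// -mulrBr normrM gtr0_norm ?invr_gt0// ler_pdivrMl//; apply.
by move=> z; rewrite normrM gtr0_norm ?invr_gt0// ler_pdivrMl.
Qed.

(** Since [iter j P] fixes constants, the difference is [iter j P] applied to y |-> iter i P h y -
    iter i P h x0, which [contr_scaled] bounds pointwise. *)
Let iter_shift h M i j : dom h -> (forall x, `|h x| <= M * W x) ->
  `|iter (i + j) P h x0 - iter i P h x0| <= M * e i.
Proof.
move=> dh hM; rewrite addnC ssrnat.iterD.
have di : dom (iter i P h) by exact: iter_dom.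
set psi := iter i P h.
rewrite -[X in _ - X](iter_cst j (psi x0) x0) -iter_B//; last first.
  exact: weighted_class_cst.
have dk : dom (fun y => M * (C * rho ^+ i * (W y + W x0))).
  do 2 apply: weighted_classZ.
  by apply: weighted_classD => //; exact: weighted_class_cst.
apply: (@le_trans _ _ (iter j P (fun y => M * (C * rho ^+ i * (W y + W x0))) x0)).
  apply: iter_norm => //; last by move=> y; exact: contr_scaled.
  by apply: weighted_classB => //; exact: weighted_class_cst.
have M0 : 0 <= M.
  have := le_trans (normr_ge0 _) (hM x0).
  by rewrite pmulr_lge0// (lt_le_trans _ (W1 x0)).
rewrite iter_Z; last first.
  by apply: weighted_classZ; apply: weighted_classD => //; exact: weighted_class_cst.
rewrite iter_Z; last by apply: weighted_classD => //; exact: weighted_class_cst.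
rewrite iter_D; [|exact: dW|exact: weighted_class_cst].
rewrite iter_cst /e !ler_wpM2l//; first by rewrite mulr_ge0// exprn_ge0.
by have := PWB j x0; lra.
Qed.

Let e_cvg0 M : M * e i @[i --> \oo] --> 0.
Proof.
rewrite /e (_ : (fun i => _) = fun i => M * C * (2 * W x0 + B) * rho ^+ i).
  rewrite -[X in _ --> X](mulr0 (M * C * (2 * W x0 + B))).
  apply: cvgMl_tmp; apply: cvg_expr.
  by rewrite ger0_norm//; case/andP: rho01.
by apply/funext => i; ring.
Qed.

Definition limit_functional (h : X -> R) : R := limn (fun i => iter i P h x0).
Local Notation pi := limit_functional.

Lemma limit_functional_rate h M : dom h -> (forall x, `|h x| <= M * W x) ->
  forall i, `|iter i P h x0 - pi h| <= M * e i.
Proof.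
move=> dh hM.
pose u i := iter i P h x0.
have M0 : 0 <= M.
  have := le_trans (normr_ge0 _) (hM x0).
  by rewrite pmulr_lge0// (lt_le_trans _ (W1 x0)).
(* Any two of the intervals [u i - M e i, u i + M e i] meet, so the supremum of their left ends lies
   in all of them. *)
have uu i j : u i - M * e i <= u j + M * e j.
  have [ij|/ltnW ji] := leqP i j.
    have := iter_shift i (j - i) dh hM; rewrite subnKC// -/(u j) -/(u i).
    rewrite ler_distl => /andP[+ _] => /le_trans; apply.
    by rewrite lerDl mulr_ge0.
  have := iter_shift j (i - j) dh hM; rewrite subnKC// -/(u j) -/(u i).
  rewrite ler_distl => /andP[_]; apply: le_trans.
  by rewrite gerBl mulr_ge0.
pose L := sup (range (fun i => u i - M * e i)).
have uL i : `|u i - L| <= M * e i.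
  rewrite distrC ler_distl; apply/andP; split.
    apply: ub_le_sup; last by exists i.
    by exists (u 0 + M * e 0) => _ [j _ <-].
  apply: ge_sup; first by exists (u 0 - M * e 0); exists 0%N.
  by move=> _ [j _ <-].
suff -> : pi h = L by [].
by apply: cvg_lim => //; exact: cvg_rate uL (e_cvg0 M).
Qed.

Lemma cvg_limit_functional h : dom h -> iter i P h x0 @[i --> \oo] --> pi h.
Proof.
move=> dh; have [_ [M hM]] := dh.
exact: cvg_rate (limit_functional_rate dh hM) (e_cvg0 M).
Qed.

Lemma limit_functionalD h k : dom h -> dom k ->
  pi (fun y => h y + k y) = pi h + pi k.
Proof.
move=> dh dk; apply: cvg_lim => //.
under eq_fun do rewrite iter_D//.
by apply: cvgD; exact: cvg_limit_functional.
Qed.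

Lemma limit_functionalZ a h : dom h -> pi (fun y => a * h y) = a * pi h.
Proof.
move=> dh; apply: cvg_lim => //.
under eq_fun do rewrite iter_Z//.
by apply: cvgMl_tmp; exact: cvg_limit_functional.
Qed.

Lemma limit_functional_cst a : pi (fun=> a) = a.
Proof.
apply: cvg_lim => //; under eq_fun do rewrite iter_cst.
exact: cvg_cst.
Qed.

Lemma limit_functional_ge0 h : dom h -> (forall x, 0 <= h x) -> 0 <= pi h.
Proof.
move=> dh h0; apply: limr_ge; first exact/cvgP/(cvg_limit_functional dh).
apply: nearW => i; rewrite -[leLHS](iter_cst i 0 x0).
by apply: iter_le => //; exact: weighted_class_cst.
Qed.

Let cvg_iter (h_ : (X -> R)^nat) (h : X -> R) (M : R) (i : nat) :
  (forall n, measurable_fun setT (h_ n)) ->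
  measurable_fun setT h -> (forall n x, `|h_ n x| <= M * W x) ->
  (forall x, `|h x| <= M * W x) ->
  (forall x, h_ n x @[n --> \oo] --> h x) ->
  iter i P (h_ n) x0 @[n --> \oo] --> iter i P h x0.
Proof.
move=> mh_ mh h_M hM h_h.
have dh_ n : dom (h_ n) by split=> //; exists M.
have dh : dom h by split=> //; exists M.
have [] := @dominated_convergence _ _ _ (law gamma mF i x0) _ measurableT
    (fun n x => (h_ n x)%:E) (EFin \o h) (fun x => (M * W x)%:E).
- by move=> n; exact/measurable_EFinP.
- exact/measurable_EFinP.
- by apply: aeW => x _; apply: cvg_EFin; [exact: nearW|exact: h_h].
- apply: (weighted_class_integrable (W := W)); last exact: weighted_classZ.
  exact: (law_integrable mF W1 mW Wc).
- by apply: aeW => x n _; rewrite lee_fin.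
move=> _ _.
rewrite (integral_law mF W1 mW Wc)//=.
under eq_fun do rewrite (integral_law mF W1 mW Wc)//.
by move/fine_cvg.
Qed.

(** The rate of convergence to the limit depends on the functions only through [M], so one time [i]
    serves the whole sequence and its limit; at that fixed time dominated convergence applies.
    Countable additivity and the representation by integrals both rest on this. *)
Lemma limit_functional_continuous (h_ : (X -> R)^nat) (h : X -> R) (M : R) :
  (forall n, measurable_fun setT (h_ n)) ->
  measurable_fun setT h -> (forall n x, `|h_ n x| <= M * W x) ->
  (forall x, `|h x| <= M * W x) ->
  (forall x, h_ n x @[n --> \oo] --> h x) ->
  pi (h_ n) @[n --> \oo] --> pi h.
Proof.
move=> mh_ mh h_M hM h_h.
have dh_ n : dom (h_ n) by split=> //; exists M.
have dh : dom h by split=> //; exists M.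
apply/cvgrPdist_le => eps eps0.
have eps3 : 0 < eps / 3 by rewrite divr_gt0.
have [i _ /(_ i (leqnn _)) /= ei] : \forall i \near \oo, `|0 - M * e i| <= eps / 3.
  by move/cvgrPdist_le : (e_cvg0 M); apply.
rewrite sub0r normrN in ei; have {}ei := le_trans (ler_norm _) ei.
near=> n.
have : `|iter i P h x0 - iter i P (h_ n) x0| <= eps / 3.
  near: n.
  by have /cvgrPdist_le := @cvg_iter h_ h M i mh_ mh h_M hM h_h; exact.
have := limit_functional_rate dh hM i.
have := limit_functional_rate (dh_ n) (h_M n) i.
rewrite !ler_distl => /andP[? ?] /andP[? ?] /andP[? ?].
apply/andP; split; lra.
Unshelve. all: by end_near. Qed.

(* The absolute value only matters on non-measurable sets, where it keeps the
   value nonnegative. *)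
Definition limit_measure (A : set X) : \bar R := `|pi (\1_A)|%:E.

Let limit_measureE A : measurable A -> limit_measure A = (pi (\1_A))%:E.
Proof.
move=> mA; rewrite /limit_measure ger0_norm//.
by apply: limit_functional_ge0; [exact: weighted_class_indic|].
Qed.

Let limit_measure0 : limit_measure set0 = 0%E.
Proof. by rewrite /limit_measure indic0 limit_functional_cst normr0. Qed.

Let limit_measure_ge0 A : (0 <= limit_measure A)%E.
Proof. by rewrite lee_fin. Qed.

(** Partial sums are the functional at indicators of finite unions, which converge pointwise to the
    indicator of the whole union. *)
Let limit_measure_sigma_additive : semi_sigma_additive limit_measure.
Proof.
move=> A mA tA mUA.
pose U n := \big[setU/set0]_(i < n) A i.
have mU n : measurable (U n) by apply: bigsetU_measurable.
pose h n : X -> R := \1_(U n).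
have hS n : h n.+1 = fun x => h n x + \1_(A n) x.
  apply/funext => x; rewrite /h /U big_ord_recr/= !indicE in_setU.
  have [xA|] := boolP (x \in A n); last by rewrite orbF addr0.
  rewrite orbT; case: (boolP (x \in _)) => [|_]; last by rewrite add0r.
  move/set_mem; rewrite -bigcup_mkord => -[k /= kn Akx]; exfalso.
  have := tA k n Logic.I Logic.I; rewrite (_ : k = n) ?ltnn// in kn *.
  by apply: tA => //; exists x; split=> //; exact: set_mem.
have dA n : dom (\1_(A n)) by exact: weighted_class_indic.
have dh n : dom (h n) by exact: weighted_class_indic.
have piS n : (\sum_(0 <= i < n) limit_measure (A i))%E = (pi (h n))%:E.
  elim: n => [|n IH].
    by rewrite big_geq// /h /U big_ord0 indic0 limit_functional_cst.
  by rewrite big_nat_recr//= IH hS limit_functionalD// limit_measureE.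
under eq_fun do rewrite piS.
rewrite limit_measureE//; apply: cvg_EFin; first exact: nearW.
apply: (@limit_functional_continuous h _ 1).
- by move=> n; exact: measurable_indic.
- exact: measurable_indic.
- by move=> n x; rewrite mul1r (le_trans _ (W1 x))// /h indicE; case: (_ \in _);
    rewrite ?normr1 ?normr0.
- by move=> x; rewrite mul1r (le_trans _ (W1 x))// indicE; case: (_ \in _);
    rewrite ?normr1 ?normr0.
move=> x; apply: cvg_near_cst.
have [[k _ Akx]|nAx] := pselect ((\bigcup_n A n) x).
  exists k.+1 => // n /= kn; rewrite /h !indicE !mem_set//; first by exists k.
  by rewrite /U -bigcup_mkord; exists k.
apply: nearW => n; rewrite /h !indicE !memNset//.
by rewrite /U -bigcup_mkord => -[k _ Akx]; apply: nAx; exists k.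
Qed.

HB.instance Definition _ := isMeasure.Build _ _ _ limit_measure
  limit_measure0 limit_measure_ge0 limit_measure_sigma_additive.

Let limit_measure_setT : limit_measure setT = 1%E.
Proof. by rewrite limit_measureE// indicT limit_functional_cst. Qed.

HB.instance Definition _ := @Measure_isProbability.Build _ _ R
  limit_measure limit_measure_setT.

Let mu : probability X R := limit_measure.

Import HBNNSimple.

Let integral_limit_nnsfun (f : {nnsfun X >-> R}) :
  (\int[mu]_x (f x)%:E)%E = (pi f)%:E.
Proof.
have mf y : measurable (f @^-1` [set y]) by [].
have sumE (s : seq R) :
    dom (fun x => \sum_(y <- s) y * \1_(f @^-1` [set y]) x) /\
    pi (fun x => \sum_(y <- s) y * \1_(f @^-1` [set y]) x) =
    \sum_(y <- s) y * pi (\1_(f @^-1` [set y])).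
  elim: s => [|y s [ds IH]].
    under eq_fun do rewrite big_nil.
    by rewrite big_nil limit_functional_cst; split=> //; exact: weighted_class_cst.
  under eq_fun do rewrite big_cons.
  have dy : dom (fun x => y * \1_(f @^-1` [set y]) x).
    by apply: weighted_classZ; exact: weighted_class_indic.
  split; first exact: weighted_classD.
  rewrite limit_functionalD// limit_functionalZ ?big_cons ?IH//.
  exact: weighted_class_indic.
rewrite integralT_nnsfun sintegralE fsbig_finite//=.
rewrite [in RHS](_ : (f : X -> R) = fun x =>
    \sum_(y <- fset_set (range f)) y * \1_(f @^-1` [set y]) x); last first.
  by apply/funext => x; rewrite [LHS]fimfunE fsbig_finite.
rewrite (sumE _).2 -sumEFin; apply: eq_bigr => y _.
by rewrite EFinM limit_measureE.
Qed.

(** Along simple functions increasing to [h], the left side converges by monotone convergence and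
    the right side by [limit_functional_continuous]. The value is finite, so [W] turns out to be
    integrable. *)
Let integral_limit_ge0 h : dom h -> (forall x, 0 <= h x) ->
  (\int[mu]_x (h x)%:E)%E = (pi h)%:E.
Proof.
move=> dh h0; have [mh [M hM]] := dh.
have meh : measurable_fun setT (EFin \o h) by exact/measurable_EFinP.
pose f := nnsfun_approx measurableT meh.
have f0 n x : 0 <= f n x by [].
have efcvg x : (f n x)%:E @[n --> \oo] --> (h x)%:E.
  by apply: (cvg_nnsfun_approx measurableT meh) => // y _; rewrite lee_fin.
have fcvg x : f n x @[n --> \oo] --> h x by have /fine_cvg := efcvg x.
have fh n x : f n x <= h x.
  rewrite -(cvg_lim _ (fcvg x))//.
  apply: (nondecreasing_cvgn_le _ (cvgP _ (fcvg x))) => a b ab.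
  exact/lefP/nd_nnsfun_approx.
have pif : (pi (f n))%:E @[n --> \oo] --> (pi h)%:E.
  apply: cvg_EFin; first exact: nearW.
  apply: (@limit_functional_continuous (fun n => f n) h M) => // n x.
  by rewrite ger0_norm// (le_trans (fh n x))// (le_trans _ (hM x))// ler_norm.
have : (\int[mu]_x (f n x)%:E)%E @[n --> \oo] --> (\int[mu]_x (h x)%:E)%E.
  have -> : (fun x => (h x)%:E) = fun x => limn (fun n => (f n x)%:E).
    by apply/funext => x; apply/esym/cvg_lim.
  apply: cvg_monotone_convergence => //.
  - by move=> n; exact/measurable_EFinP.
  - by move=> n x _; rewrite lee_fin.
  - by move=> x _ m n mn; rewrite lee_fin; exact/lefP/nd_nnsfun_approx.
under eq_fun do rewrite integral_limit_nnsfun.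
by move/cvg_unique; apply.
Qed.

Lemma limit_measure_integrable : mu.-integrable setT (EFin \o W).
Proof.
apply/integrableP; split; first exact/measurable_EFinP.
under eq_integral do rewrite /= ger0_norm//.
by rewrite integral_limit_ge0// ltry.
Qed.

Lemma integral_limit_measure h : dom h -> (\int[mu]_x (h x)%:E)%E = (pi h)%:E.
Proof.
move=> dh; have [mh [M hM]] := dh.
have iW : mu.-integrable setT (fun x => (M * W x)%:E).
  apply: (weighted_class_integrable (W := W)); last exact: weighted_classZ.
  exact: limit_measure_integrable.
have ih : mu.-integrable setT (EFin \o h).
  exact: weighted_class_integrable limit_measure_integrable dh.
(* Adding M W, with |h| <= M W, reduces a signed [h] to the nonnegative case; the integral of M W
   cancels at the end. *)
have dhW : dom (fun x => h x + M * W x).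
  by apply: weighted_classD => //; exact: weighted_classZ.
have := integral_limit_ge0 dhW; rewrite limit_functionalD//; last first.
  exact: weighted_classZ.
under eq_integral do rewrite EFinD.
rewrite integralD_EFin// EFinD.
rewrite (integral_limit_ge0 (h := fun x => M * W x)); last 2 first.
- exact: weighted_classZ.
- by move=> x; rewrite (le_trans _ (hM x)).
rewrite -[X in (X + _)%E = _](fineK (integrable_fin_num measurableT ih)).
rewrite -!EFinD => H; rewrite -[LHS](fineK (integrable_fin_num measurableT ih)).
congr EFin; suff /H[/addIr ->] : forall x, 0 <= h x + M * W x by [].
by move=> x; have := hM x; rewrite ler_norml => /andP[]; lra.
Qed.

(** Replacing the indicator by its average shifts the sequence [iter i P (\1_A) x0] by one, which
    leaves its limit unchanged. *)
Lemma limit_measure_invariant A : measurable A ->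
  (\int[mu]_x gamma [set z | A (F (x, z))])%E = mu A.
Proof.
move=> mA; have dA : dom (\1_A) by exact: weighted_class_indic.
have dPA : dom (P (\1_A)) by exact: (iter_dom 1).
transitivity (\int[mu]_x (P (\1_A) x)%:E)%E.
  apply: eq_integral => x _; rewrite (EFin_avg mF W1 mW Wc)//.
  have mAx : measurable [set z | A (F (x, z))].
    rewrite -[X in measurable X]setTI.
    exact: (measurableT_comp mF (pair1_measurable x)).
  transitivity (\int[gamma]_z (\1_[set z | A (F (x, z))] z)%:E)%E.
    by rewrite integral_indic// setIT.
  by apply: eq_integral.
rewrite integral_limit_measure//.
rewrite /mu/= limit_measureE//; congr EFin.
apply: cvg_lim => //.
under eq_fun do rewrite -iterSr.
have := cvg_limit_functional dA.
by rewrite -(cvg_shiftS (fun i => iter i P (\1_A) x0)).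
Qed.

Lemma limit_measure_rate (g : X -> R) : measurable_fun setT g ->
  (forall x, `|g x| <= W x) -> forall i x,
  (`|(iter i P g x)%:E - \int[mu]_y (g y)%:E| <=
   (C * (1 + 3 * W x0 + B) * rho ^+ i * W x)%:E)%E.
Proof.
move=> mg gW i x.
have gW' y : `|g y| <= 1 * W y by rewrite mul1r.
have dg : dom g by split=> //; exists 1.
rewrite integral_limit_measure// lee_fin.
have h1 := contr dg gW i x x0.
have h2 := limit_functional_rate dg gW' i.
rewrite mul1r in h2.
(* Comparison through the base point: the two pieces contribute W x + W x0 and 2 W x0 + B, and W x
   >= 1 turns their sum into a multiple of W x. *)
rewrite (_ : _ - _ = (iter i P g x - iter i P g x0) + (iter i P g x0 - pi g)).
  apply: (le_trans (ler_normD _ _)); apply: (le_trans (lerD h1 h2)).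
  rewrite /e -mulrDr -[in leRHS]mulrA -!mulrA ler_wpM2l// !mulrA.
  rewrite [leRHS]mulrAC [leRHS]mulrC ler_wpM2l ?exprn_ge0//.
  have : W x0 <= W x0 * W x by rewrite ler_peMr.
  have : B <= B * W x by rewrite ler_peMr.
  by lra.
by ring.
Qed.

Theorem invariant_measure_of_contraction : exists2 mu : probability X R,
  forall A, measurable A -> (\int[mu]_x gamma [set z | A (F (x, z))])%E = mu A &
  forall g : X -> R, measurable_fun setT g -> (forall x, `|g x| <= W x) ->
  forall i x, (`|(iter i P g x)%:E - \int[mu]_y (g y)%:E| <=
    (C * (1 + 3 * W x0 + B) * rho ^+ i * W x)%:E)%E.
Proof.
exists mu; [exact: limit_measure_invariant|exact: limit_measure_rate].
Qed.

End invariant_measure_of_contraction.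

(** By invariance, nu A is the integral of [iter i (avg gamma F) (\1_A)] against [nu] for every i,
    and dominated convergence with bound 1 lets i tend to infinity. The constant weight [one] is
    used because nothing is known about moments of [nu]. *)
Lemma invariant_measure_unique d d' (X : measurableType d)
    (Z : measurableType d') (R : realType) (gamma : probability Z R)
    (F : X * Z -> X) (mu nu : probability X R) :
  measurable_fun setT F ->
  (forall A, measurable A -> forall x,
    iter i (avg gamma F) (\1_A) x @[i --> \oo] --> fine (mu A)) ->
  (forall A, measurable A ->
    (\int[nu]_x gamma [set z | A (F (x, z))])%E = nu A) ->
  forall A, measurable A -> nu A = mu A.
Proof.
move=> mF cvgmu inv A mA.
pose one : X -> R := fun=> 1.
have one1 x : 1 <= one x by [].
have mone : measurable_fun setT one by exact: measurable_cst.
have one_c x : (\int[gamma]_z (one (F (x, z)))%:E <= (1 * one x)%:E)%E.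
  have -> : (\int[gamma]_z (one (F (x, z)))%:E = \int[gamma]_z cst 1 z)%E by [].
  by rewrite integral_cst// mul1e mul1r probability_le1.
have ione (m : probability X R) : m.-integrable setT (EFin \o one).
  exact: finite_measure_integrable_cst.
have dA : weighted_class one (\1_A) by exact: weighted_class_indic.
have push_nu h : weighted_class one h ->
    (\int[nu]_x (avg gamma F h x)%:E = \int[nu]_x (h x)%:E)%E.
  move=> dh; rewrite -(integral_push mF one1 mone one_c (ione nu) dh).
  apply: eq_measure_integral => B mB _.
  by rewrite -[RHS]inv//; exact: pushE.
have iterE i : (\int[nu]_x (iter i (avg gamma F) (\1_A) x)%:E = nu A)%E.
  elim: i => [|i IH] /=; first by rewrite integral_indic// setIT.
  by rewrite push_nu//; exact: (iter_avg_weighted mF one1 mone one_c).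
have iter01 i x : 0 <= iter i (avg gamma F) (\1_A) x <= 1.
  rewrite -!lee_fin -(law_indic mF one1 mone one_c)// measure_ge0.
  exact: probability_le1.
have [] := @dominated_convergence _ _ _ nu _ measurableT
    (fun i x => (iter i (avg gamma F) (\1_A) x)%:E) (fun=> mu A)
    (fun x => (one x)%:E).
- move=> i; apply/measurable_EFinP.
  by have [] := iter_avg_weighted mF one1 mone one_c i dA.
- exact: measurable_cst.
- apply: aeW => x _; rewrite -(fineK (fin_num_measure mu A mA)).
  by apply: cvg_EFin; [exact: nearW|exact: cvgmu].
- exact: ione.
- apply: aeW => x i _; rewrite lee_fin.
  by have /andP[h0 h1] := iter01 i x; rewrite ger0_norm.
move=> _ _; rewrite -[X in _ --> X]/(\int[nu]_x cst (mu A) x)%E integral_cst//.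
rewrite (_ : (fun i => _) = cst (nu A)); last exact/funext.
have /= -> := @probability_setT _ _ _ nu; rewrite mule1 => h.
by rewrite -(cvg_lim _ h)// lim_cst.
Qed.

Section harris_theorem.
Context d d' (X : measurableType d) (Z : measurableType d') (R : realType).
Variables (gamma : probability Z R) (F : X * Z -> X).
Hypothesis mF : measurable_fun setT F.
Variables (V : X -> R) (q K : R) (n : nat) (x0 : X).
Hypotheses (mV : measurable_fun setT V) (V0 : forall x, 0 <= V x).
Hypotheses (q0 : 0 <= q) (q1 : q < 1) (K0 : 0 <= K).
Hypothesis drift :
  forall x, (\int[gamma]_z (V (F (x, z)))%:E <= (q * V x + K)%:E)%E.
Local Notation W := (fun x => 1 + V x).
Hypotheses (n0 : (0 < n)%N)
  (minor : minorization (weighted_class W) V (iter n (avg gamma F))).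

Let W1 x : 1 <= W x. Proof. by rewrite lerDl. Qed.
Let mW : measurable_fun setT W.
Proof. by apply: measurable_funD => //; exact: measurable_cst. Qed.

(** One-step growth of the weight 1 + V: the condition under which [avg] acts on the weighted
    class. *)
Lemma drift_weight x : (\int[gamma]_z (W (F (x, z)))%:E <= ((1 + K) * W x)%:E)%E.
Proof.
have [q1' K0'] := (q1, K0).
have mVF : measurable_fun setT (fun z => (V (F (x, z)))%:E).
  apply/measurable_EFinP; apply: measurableT_comp mV _.
  exact: measurableT_comp mF (pair1_measurable x).
rewrite (eq_integral (fun z => cst 1%E z + (V (F (x, z)))%:E)%E)//.
rewrite ge0_integralD//; last by move=> z _; rewrite lee_fin.
rewrite integral_cst//; have /= -> := @probability_setT _ _ _ gamma.
rewrite mule1; apply: (@le_trans _ _ (1 + (q * V x + K)%:E)%E); first exact: leeD2l.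
rewrite -EFinD lee_fin mulrDr mulr1 mulrDl mul1r.
have : q * V x <= V x by rewrite ler_piMl// ltW.
have : 0 <= K * V x by rewrite mulr_ge0.
by lra.
Qed.

Let dV : weighted_class W V.
Proof.
by split=> //; exists 1 => x; rewrite mul1r ger0_norm// lerDr.
Qed.

Let mP := avg_markov mF W1 mW drift_weight.

Let drift' x : avg gamma F V x <= q * V x + K.
Proof. by rewrite -lee_fin (EFin_avg mF W1 mW drift_weight). Qed.

Let iterW i x : iter i (avg gamma F) W x <= W x + K / (1 - q).
Proof.
have [DB DZ Dc] : [/\ forall h k, weighted_class W h -> weighted_class W k ->
    weighted_class W (fun x => h x - k x),
    forall a h, weighted_class W h -> weighted_class W (fun x => a * h x) &
    forall a, weighted_class W (fun=> a)].
  split => *; [exact: weighted_classB|exact: weighted_classZ|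
    exact: weighted_class_cst].
have := @markov_operator_drift _ _ _ DB DZ Dc _ _ _ _ i mP q0 q1 K0 dV drift' x.
have mPi := markov_operator_iter i mP.
rewrite (markov_operatorD DZ mPi)//.
have [_ _ _ -> _] := mPi => h.
rewrite -addrA lerD2l (le_trans h)// lerD2r ler_piMl// exprn_ile1// ltW//.
Qed.

Theorem harris_theorem : exists mu : probability X R,
  [/\ forall A, measurable A -> (\int[mu]_x gamma [set z | A (F (x, z))])%E = mu A,
      forall nu : probability X R,
        (forall A, measurable A -> (\int[nu]_x gamma [set z | A (F (x, z))])%E = nu A) ->
        forall A, measurable A -> nu A = mu A &
      exists2 C : R, 0 <= C & exists2 rho : R, 0 < rho < 1 &
        forall g : X -> R, measurable_fun setT g -> (forall x, `|g x| <= 1 + V x) ->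
        forall i x, (`|(iter i (avg gamma F) g x)%:E - \int[mu]_y (g y)%:E| <=
          (C * rho ^+ i * (1 + V x))%:E)%E].
Proof.
have DB h k : weighted_class W h -> weighted_class W k ->
  weighted_class W (fun x => h x - k x) by exact: weighted_classB.
have DZ a h : weighted_class W h -> weighted_class W (fun x => a * h x).
  exact: weighted_classZ.
have Dc a : weighted_class W (fun=> a) by exact: weighted_class_cst.
have [C C0 [rho rho01 contr]] :=
  harris_contraction DB DZ Dc mP q0 q1 K0 dV V0 drift' n0 minor.
have B0 : 0 <= K / (1 - q) by rewrite divr_ge0// subr_ge0 ltW.
have contr' phi : weighted_class W phi -> (forall x, `|phi x| <= W x) ->
    forall i x y, `|iter i (avg gamma F) phi x - iter i (avg gamma F) phi y| <=
      C * rho ^+ i * (W x + W y).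
  move=> dphi phiW i x y; rewrite (_ : W x + W y = 2 + (V x + V y)); first exact: contr.
  by ring.
have [mu inv rate] :=
  invariant_measure_of_contraction mF W1 mW drift_weight iterW C0 rho01 contr' x0.
exists mu; split=> //.
- move=> nu invnu A mA.
  (* Setwise convergence to [mu] is the rate applied to indicators, which are bounded by 1 <= W. *)
  apply: (invariant_measure_unique mF _ invnu) => // {}A {}mA x.
  have IA y : `|\1_A y : R| <= W y.
    by rewrite (le_trans _ (W1 y))// indicE; case: (_ \in _); rewrite ?normr1 ?normr0.
  have mIA : measurable_fun setT (\1_A : X -> R) by exact: measurable_indic.
  pose e i := C * (1 + 3 * W x0 + K / (1 - q)) * rho ^+ i * W x.
  apply: (@cvg_rate _ _ e).
    move=> i; have := rate _ mIA IA i x.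
    rewrite integral_indic// setIT -[X in (`|_ - X|)%E]fineK ?fin_num_measure//.
  rewrite /e (_ : (fun i => _) = fun i => C * (1 + 3 * W x0 + K / (1 - q)) * W x * rho ^+ i).
    rewrite -[X in _ --> X](mulr0 (C * (1 + 3 * W x0 + K / (1 - q)) * W x)).
    apply: cvgMl_tmp; apply: cvg_expr.
    by case/andP: rho01 => /ltW r0 r1; rewrite ger0_norm.
  by apply/funext => i; ring.
- exists (C * (1 + 3 * W x0 + K / (1 - q))).
    by rewrite mulr_ge0// !addr_ge0// mulr_ge0// (le_trans _ (W1 x0)).
  by exists rho.
Qed.

End harris_theorem.

(** * The normal distribution *)

Section normal.
Context (R : realType).
Local Notation leb := (@lebesgue_measure R).

(** [normal_prob] is given by its values on sets; its Radon-Nikodym derivative has the same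
    integrals over measurable sets as [normal_pdf], hence equals it almost everywhere. *)
Lemma ge0_integral_normal_prob (m s : R) (g : R -> \bar R) :
  measurable_fun setT g -> (forall x, 0 <= g x)%E ->
  (\int[normal_prob m s]_x g x = \int[leb]_x (g x * (normal_pdf m s x)%:E))%E.
Proof.
move=> mg g0; have dom := normal_prob_dominates m s.
have mpdf : measurable_fun setT (EFin \o normal_pdf m s).
  by apply/measurable_EFinP; exact: measurable_normal_pdf.
have ifRN := Radon_Nikodym_SigmaFinite.f_integrable dom.
rewrite -(Radon_Nikodym_SigmaFinite.change_of_variables dom)//.
apply: ae_eq_integral => //.
- by apply: emeasurable_funM => //; exact: measurable_int ifRN.
- exact: emeasurable_funM.
- apply: ae_eqe_mul2l; apply: integral_ae_eq => // E _ mE.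
  by rewrite -(Radon_Nikodym_SigmaFinite.f_integral dom).
Qed.

(** |z|^k <= k! e^|z|, and |z| - z^2 / 2 <= 1 - z^2 / 4 by (|z| / 2 - 1)^2 >= 0, so the integrand
    lies below a multiple of the normal density of variance 2. *)
Lemma normal_moment_lty (k : nat) :
  (\int[normal_prob (0 : R) 1]_z (`|z| ^+ k)%:E < +oo)%E.
Proof.
have s2 : Num.sqrt 2 != 0 :> R by rewrite sqrtr_eq0 -ltNge.
have mX : measurable_fun setT (fun z : R => (`|z| ^+ k)%:E).
  by apply/measurable_EFinP; apply: measurable_funX; exact: normr_measurable.
rewrite ge0_integral_normal_prob//.
pose K : R := k`!%:R * expR 1 * normal_peak 1 / normal_peak (Num.sqrt 2).
have K0 : 0 <= K.
  by rewrite divr_ge0 ?normal_peak_ge0// !mulr_ge0 ?expR_ge0 ?normal_peak_ge0.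
apply: (@le_lt_trans _ _ (\int[leb]_z (K%:E * (normal_pdf 0 (Num.sqrt 2) z)%:E))%E).
  apply: ge0_le_integral => //.
  - by move=> z _; rewrite mule_ge0 ?lee_fin ?normal_pdf_ge0.
  - apply: emeasurable_funM => //.
    by apply/measurable_EFinP; exact: measurable_normal_pdf.
  - apply: measurable_funeM.
    by apply/measurable_EFinP; exact: measurable_normal_pdf.
  move=> z _; rewrite -!EFinM lee_fin !normal_pdfE ?oner_eq0//.
  rewrite /K /normal_fun !subr0.
  have -> : k`!%:R * expR 1 * normal_peak 1 / normal_peak (Num.sqrt 2) *
    (normal_peak (Num.sqrt 2) * expR (- z ^+ 2 / (Num.sqrt 2 ^+ 2 *+ 2))) =
    normal_peak 1 * (k`!%:R * (expR 1 * expR (- z ^+ 2 / (Num.sqrt 2 ^+ 2 *+ 2)))).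
    by field; rewrite gt_eqF// normal_peak_gt0.
  rewrite mulrCA ler_wpM2l ?normal_peak_ge0//.
  apply: (@le_trans _ _ ((k`!%:R * expR `|z|) * expR (- z ^+ 2 / (1 ^+ 2 *+ 2)))).
    rewrite ler_wpM2r ?expR_ge0//.
    have k0 : 0 < k`!%:R :> R by rewrite ltr0n fact_gt0.
    case: k k0 {mX K K0} => [|k] k0.
      by rewrite expr0 fact0 mul1r; apply: le_trans (expR_ge1Dx _); rewrite lerDl.
    have := @expR_ge1Dxn R `|z| k (normr_ge0 _).
    rewrite -ler_pdivrMl// mulrC => /(le_trans _); apply.
    by rewrite lerDr.
  rewrite -mulrA -!expRD ler_wpM2l// ler_expR.
  rewrite sqr_sqrtr// expr1n -[z ^+ 2]real_normK ?num_real//.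
  move: (`|z|) => y; have := sqr_ge0 (y / 2 - 1).
  have -> : (2 *+ 2 : R) = 4 by rewrite -mulrnA.
  have -> : (y / 2 - 1) ^+ 2 = y ^+ 2 / 4 - y + 1 by field.
  by lra.
rewrite integralZl//; last exact: integrable_normal_pdf.
by rewrite integral_normal_pdf// mule1 ltry.
Qed.

(** The rescaled image measure agrees with Lebesgue measure on half-open intervals. Negative [s]
    must be covered because the noise coefficients carry the signs [c1], [c2]. *)
Lemma lebesgue_measure_affine (m s : R) (B : set R) : s != 0 -> measurable B ->
  (`|s|%:E * leb ((fun z => (m + s * z)%R) @^-1` B) = leb B)%E.
Proof.
move=> s0 mB; have ns0 : 0 < `|s| by rewrite normr_gt0.
have mf : measurable_fun setT (fun z : measurableTypeR R => m + s * z : measurableTypeR R).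
  apply: (@measurable_funD _ _ _ _ (cst m)); first exact: measurable_cst.
  exact: mulrl_measurable.
pose nu : {measure set (measurableTypeR R) -> \bar R} :=
  mscale (NngNum (ltW ns0))
    (pushforward leb (fun z : measurableTypeR R => m + s * z : measurableTypeR R)).
apply/esym/(@lebesgue_measure_unique _ (nu mf)) => // _ [[a b]] _ <-.
rewrite /nu /= /mscale /=.
rewrite (_ : pushforward _ _ _ = leb ((fun z => m + s * z)%R @^-1` `]a, b]))//.
have [ab|ba] := ltP a b; last first.
  rewrite set_itv_ge ?bnd_simp -?leNgt// preimage_set0 !measure0 mule0//.
have [sp|sn|s00] := ltgtP s 0; last by rewrite s00 eqxx in s0.
- rewrite (_ : _ @^-1` _ = `[(b - m) / s, (a - m) / s[%classic); last first.
    apply/seteqP; split => z /=; rewrite !in_itv/= => /andP[h1 h2]; apply/andP.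
      by rewrite ler_ndivrMr// ltr_ndivlMr// [z * s]mulrC; split; lra.
    by move: h1 h2; rewrite ler_ndivrMr// ltr_ndivlMr// [z * s]mulrC; split; lra.
  rewrite !lebesgue_measure_itv/= !lte_fin ab ltr_ndivrMr// divfK ?lt_eqF//.
  rewrite ltrD2r ab -!EFinD -EFinM ltr0_norm//; congr EFin.
  by field.
- rewrite (_ : _ @^-1` _ = `](a - m) / s, (b - m) / s]%classic); last first.
    apply/seteqP; split => z /=; rewrite !in_itv/= => /andP[h1 h2]; apply/andP.
      by rewrite ler_pdivlMr// ltr_pdivrMr// [z * s]mulrC; split; lra.
    by move: h1 h2; rewrite ler_pdivlMr// ltr_pdivrMr// [z * s]mulrC; split; lra.
  rewrite !lebesgue_measure_itv/= !lte_fin ab ltr_pdivrMr// divfK ?gt_eqF//.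
  rewrite ltrD2r ab -!EFinD -EFinM gtr0_norm//; congr EFin.
  by field.
Qed.

(* Clamping makes uniform noise bounded everywhere and not only almost surely. *)
Definition clamp01 (w : R) : R := Num.max 0 (Num.min w 1).

Lemma clamp01_itv w : 0 <= clamp01 w <= 1.
Proof. by rewrite /clamp01 le_max lexx ge_max ler01 ge_min lexx orbT. Qed.

Lemma clamp01_id w : 0 <= w <= 1 -> clamp01 w = w.
Proof. by move=> /andP[w0 w1]; rewrite /clamp01 (min_idPl w1) (max_idPr w0). Qed.

Lemma measurable_clamp01 : measurable_fun setT clamp01.
Proof.
by apply: measurable_maxr; [exact: measurable_cst|apply: measurable_minr].
Qed.

Let unif := uniform_prob (@ltr01 R).

(** If m + s z lies in [a, a + 1], then |z| <= (A + 1 + M) / s0 = [Z], where the normal density is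
    at least [p]; the substitution z |-> m + s z brings a factor 1 / |s| >= 1 / s1. *)
Lemma normal_prob_ge_uniform (A M s0 s1 : R) : 0 < s0 ->
  exists2 delta : R, 0 < delta &
    forall a m s : R, `|a| <= A -> `|m| <= M -> s0 <= `|s| <= s1 ->
    forall B : set R, measurable B ->
    (delta%:E * unif [set w | B (a + clamp01 w)%R] <=
     normal_prob (0 : R) 1 [set z | B (m + s * z)%R])%E.
Proof.
move=> s00.
pose Z := (A + 1 + M) / s0.
pose p := normal_peak (1 : R) * expR (- Z ^+ 2 / 2).
have p0 : 0 < p by rewrite mulr_gt0 ?expR_gt0// normal_peak_gt0.
(* [|s1| + 1] keeps the quotient positive whatever the value of [s1]. *)
exists (p / (`|s1| + 1)) => [|a m s aA mM /andP[s0s ss1] B mB].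
  by rewrite divr_gt0// ltr_wpDl.
have sp : 0 < `|s| by exact: lt_le_trans s0s.
have sN0 : s != 0 by rewrite -normr_gt0.
have maff (r t : R) : measurable_fun setT (fun z : R => r + t * z).
  apply: (@measurable_funD _ _ _ _ (cst r)); first exact: measurable_cst.
  exact: mulrl_measurable.
pose I : set R := [set y | 0 <= y - a <= 1].
have mI : measurable I.
  rewrite (_ : I = `[a, a + 1]%classic).
    exact: measurable_itv.
  apply/seteqP; split => y /=; rewrite /I/= in_itv/= => /andP[? ?]; apply/andP;
    split; lra.
have mBI : measurable (B `&` I) by exact: measurableI.
have mpre r t (D : set R) : measurable D -> measurable ((fun z : R => r + t * z) @^-1` D).
  by move=> mD; rewrite -[X in measurable X]setTI; exact: maff.
have unifE : unif [set w | B (a + clamp01 w)] = leb (B `&` I).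
  rewrite /unif /uniform_prob integral_uniform_pdf.
  have -> : [set w | B (a + clamp01 w)] `&` `[0, 1] = (fun z => a + 1 * z) @^-1` (B `&` I).
    apply/seteqP; split => z /=; rewrite in_itv/= mul1r /I/= addrAC subrr add0r.
      by move=> [+ z01]; rewrite clamp01_id.
    by move=> [? z01]; rewrite clamp01_id.
  rewrite -[RHS](@lebesgue_measure_affine a 1)// normr1 mul1e.
  under eq_integral => z.
    rewrite inE /= mul1r /I/= addrAC subrr add0r /uniform_pdf => -[_ ->].
    rewrite subr0 invr1. over.
  by rewrite integral_cst// ?mul1e//; exact: mpre.
rewrite unifE -(@lebesgue_measure_affine m s)//.
set D := _ @^-1` _.
have mD : measurable D by exact: mpre.
apply: (@le_trans _ _ (p%:E * leb D)%E).
  rewrite muleA lee_wpmul2r// -EFinM lee_fin.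
  rewrite -mulrA ler_piMr ?(ltW p0)// mulrC ler_pdivrMr ?ltr_wpDl// mul1r.
  by rewrite (le_trans ss1)// (le_trans (ler_norm _))// lerDl.
rewrite -(integral_cst leb mD p%:E) /normal_prob.
have mpdf : measurable_fun setT (fun x : R => (normal_pdf 0 1 x)%:E).
  by apply/measurable_EFinP; exact: measurable_normal_pdf.
apply: (@le_trans _ _ (\int[leb]_(x in D) (normal_pdf 0 1 x)%:E)%E).
  apply: ge0_le_integral => //.
  - by move=> x _ /=; rewrite lee_fin ltW.
  - exact: measurable_funTS.
  move=> z [_ /= /andP[z0 z1]].
  rewrite lee_fin normal_pdfE ?oner_eq0// /p ler_wpM2l ?normal_peak_ge0//.
  rewrite /normal_fun subr0 expr1n ler_expR !mulNr lerN2 ler_wpM2r//.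
  rewrite -[leLHS]real_normK ?num_real// ler_pXn2r ?nnegrE//; last first.
    rewrite /Z divr_ge0 ?(ltW s00)//.
    by have := normr_ge0 a; have := normr_ge0 m; lra.
  rewrite ler_pdivlMr// (le_trans (ler_wpM2l _ s0s))// -normrM.
  rewrite (_ : z * s = (m + s * z - a) + a - m); last by ring.
  rewrite (le_trans (ler_normB _ _))// (le_trans (lerD (ler_normD _ _) (lexx _)))//.
  by rewrite ger0_norm//; lra.
apply: ge0_subset_integral => //.
- exact: mpre.
- exact: measurable_funTS.
- by move=> x _; rewrite lee_fin normal_pdf_ge0.
- by move=> z [].
Qed.

Lemma integral_normal_prob_ge_uniform (A M s0 s1 : R) : 0 < s0 ->
  exists2 delta : R, 0 < delta &
    forall a m s : R, `|a| <= A -> `|m| <= M -> s0 <= `|s| <= s1 ->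
    forall h : R -> \bar R, measurable_fun setT h -> (forall x, 0 <= h x)%E ->
    (delta%:E * \int[unif]_w h (a + clamp01 w)%R <=
     \int[normal_prob (0 : R) 1]_z h (m + s * z)%R)%E.
Proof.
move=> s00; have [delta d0 H] := @normal_prob_ge_uniform A M s0 s1 s00.
exists delta => // a m s aA mM ss h mh h0.
have mshift : measurable_fun setT (fun w : measurableTypeR R => a + clamp01 w : measurableTypeR R).
  apply: (@measurable_funD _ _ _ _ (cst a)); first exact: measurable_cst.
  exact: measurable_clamp01.
have maff : measurable_fun setT (fun z : measurableTypeR R => m + s * z : measurableTypeR R).
  apply: (@measurable_funD _ _ _ _ (cst m)); first exact: measurable_cst.
  exact: mulrl_measurable.
pose mu1 : {measure set (measurableTypeR R) -> \bar R} :=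
  mscale (NngNum (ltW d0)) (pushforward unif
    (fun w : measurableTypeR R => a + clamp01 w : measurableTypeR R)).
pose mu2 : {measure set (measurableTypeR R) -> \bar R} :=
  pushforward (normal_prob (0 : R) 1) (fun z : measurableTypeR R => m + s * z : measurableTypeR R).
have m12 S : measurable S -> (mu1 mshift S <= mu2 maff S)%E.
  by move=> mS; exact: H.
have := ge0_le_measure_integral m12 measurableT h0 mh.
by rewrite ge0_integral_mscale// !ge0_integral_pushforward.
Qed.

(** The crossed [z.2], [z.1] reflect that the second noise component drives the first block. The
    one-dimensional bound is applied to one coordinate at a time. *)
Lemma normal2_ge_uniform2 (A M s0 s1 : R) : 0 < s0 ->
  exists2 delta : R, 0 < delta &
    forall a1 a2 m1 m2 t1 t2 : R, `|a1| <= A -> `|a2| <= A ->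
    `|m1| <= M -> `|m2| <= M -> s0 <= `|t1| <= s1 -> s0 <= `|t2| <= s1 ->
    forall h : R * R -> \bar R, measurable_fun setT h -> (forall x, 0 <= h x)%E ->
    (delta%:E * \int[unif \x unif]_w h (a1 + clamp01 w.1, a2 + clamp01 w.2)%R <=
     \int[normal_prob (0 : R) 1 \x normal_prob (0 : R) 1]_z
       h (m1 + t1 * z.2, m2 + t2 * z.1)%R)%E.
Proof.
move=> s00; have [delta d0 H] := @integral_normal_prob_ge_uniform A M s0 s1 s00.
exists (delta * delta) => [|a1 a2 m1 m2 t1 t2 aA1 aA2 mM1 mM2 ss1 ss2 h mh h0].
  by rewrite mulr_gt0.
have maff (m t : R) : measurable_fun setT (fun z : R => m + t * z).
  apply: (@measurable_funD _ _ _ _ (cst m)); first exact: measurable_cst.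
  exact: mulrl_measurable.
have mshift (a : R) : measurable_fun setT (fun w : R => a + clamp01 w).
  apply: (@measurable_funD _ _ _ _ (cst a)); first exact: measurable_cst.
  exact: measurable_clamp01.
have mh1 : measurable_fun setT (fun z : R * R => h (m1 + t1 * z.2, m2 + t2 * z.1)).
  apply: measurableT_comp mh _; apply: measurable_fun_pair.
    exact: measurableT_comp (maff m1 t1) measurable_snd.
  exact: measurableT_comp (maff m2 t2) measurable_fst.
have mh2 : measurable_fun setT (fun w : R * R => h (a1 + clamp01 w.1, a2 + clamp01 w.2)).
  apply: measurableT_comp mh _; apply: measurable_fun_pair.
    exact: measurableT_comp (mshift a1) measurable_fst.
  exact: measurableT_comp (mshift a2) measurable_snd.
have mh3 : measurable_fun setT (fun z : R * R => h (z.1, a2 + clamp01 z.2)).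
  apply: measurableT_comp mh _; apply: measurable_fun_pair.
    exact: measurable_fst.
  exact: measurableT_comp (mshift a2) measurable_snd.
pose k (y : R) := (\int[unif]_w h (y, a2 + clamp01 w)%R)%E.
have mk : measurable_fun setT k.
  exact: (measurable_fun_fubini_tonelli_F (m2 := unif) _ mh3).
have k0 y : (0 <= k y)%E by exact: integral_ge0.
(* The orders of integration are opposite on the two sides, because [w.1] on the left corresponds to
   [z.2] on the right. *)
rewrite [leRHS]fubini_tonelli2// [X in (_ * X)%E]fubini_tonelli1// EFinM -muleA.
apply: (@le_trans _ _ (delta%:E *
    \int[normal_prob (0 : R) 1]_z k (m1 + t1 * z)%R)%E).
  by rewrite lee_pmul2l ?lte_fin//; exact: H.
rewrite -ge0_integralZl//; last 2 first.
- exact: measurableT_comp mk (maff m1 t1).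
- by rewrite lee_fin ltW.
apply: ge0_le_integral => //.
- by move=> z _; rewrite mule_ge0// lee_fin ltW.
- by apply: measurable_funeM; exact: measurableT_comp mk (maff m1 t1).
- exact: (measurable_fun_fubini_tonelli_G (m1 := normal_prob (0 : R) 1) _ mh1).
move=> z _; rewrite /k /fubini_G /=.
apply: (H a2 m2 t2 aA2 mM2 ss2 (fun y => h (m1 + t1 * z, y))) => //.
exact: measurableT_comp mh (pair1_measurable _).
Qed.

End normal.

(** * Matrix exponentials of the drift *)

Lemma cvg_mx (R : numFieldType) (m n : nat) (f : nat -> 'M[R]_(m, n))
    (M : 'M[R]_(m, n)) :
  (forall i j, f k i j @[k --> \oo] --> M i j) -> f k @[k --> \oo] --> M.
Proof.
move=> fM A [P MP sPA].
have H : \forall k \near \oo, forall ij : 'I_m * 'I_n, P ij.1 ij.2 (f k ij.1 ij.2).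
  apply: filter_forall => -[i j] /=; exact: fM (MP i j).
by apply: filterS H => k H; apply: sPA => i j; exact: H (i, j).
Qed.

Lemma block_diag_expr (R : pzRingType) (m n k : nat) (A : 'M[R]_m) (B : 'M[R]_n) :
  (block_mx A 0 0 B) ^+ k = block_mx (A ^+ k) 0 0 (B ^+ k).
Proof.
elim: k => [|k IH]; first by rewrite !expr0 -!scalar_mx_block.
rewrite !exprS IH -!mulmxE mulmx_block.
by rewrite !mul0mx !mulmx0 !addr0 !add0r.
Qed.

(* [exprZn] lives in the ring of nonempty matrices, whose unification with
   'M_(m + n) is blocked. *)
Lemma expr_scalemx (R : comPzRingType) (n k : nat) (a : R) (A : 'M[R]_n) :
  (a *: A) ^+ k = a ^+ k *: A ^+ k.
Proof.
elim: k => [|k IH]; first by rewrite !expr0 scale1r.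
by rewrite !exprS IH -!mulmxE -scalemxAl -scalemxAr scalerA.
Qed.

Section drift_exponential.
Context (R : realType) (eta : nat) (nu : R).
Local Notation A := (drift_block eta nu).

(** The matrix is -nu I + S with S the nilpotent shift; this is the coefficient of S^(j - i) in the
    binomial formula, obtained by Pascal's rule. If j - i > k the exponent truncates to 0, but the
    binomial coefficient vanishes. *)
Lemma drift_block_expr k (i j : 'I_eta.+1) :
  (A ^+ k) i j = if (i <= j)%N
    then 'C(k, j - i)%:R * (- nu) ^+ (k - (j - i)) else 0.
Proof.
elim: k i j => [|k IH] i j.
  rewrite expr0 mxE; have [->|ij] := eqVneq i j.
    by rewrite leqnn subnn bin0 mul1r.
  case: ifPn => // leij; rewrite bin0n subn_eq0.
  have /negbTE -> : ~~ (j <= i)%N by rewrite -ltnNge ltn_neqAle ij.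
  by rewrite mul0r.
rewrite exprSr -mulmxE mxE.
have colj (l : 'I_eta.+1) : A l j = (if l == j then - nu else 0) +
    (if j == l.+1 :> nat then 1 else 0).
  rewrite mxE; have [->|lj] := eqVneq l j; last by rewrite add0r.
  by rewrite -[_ == _]/(j == j.+1 :> nat) (ltn_eqF (ltnSn j)) addr0.
under eq_bigr do rewrite colj mulrDr.
rewrite big_split/= (bigD1 j)//= eqxx big1 ?addr0; last first.
  by move=> l /negbTE ->; rewrite mulr0.
have [j0|j0] := posnP j.
  rewrite big1 ?addr0; last by move=> l _; rewrite j0 mulr0.
  rewrite IH j0 leqn0; case: eqP => [i0|_]; last by rewrite mul0r.
  by rewrite i0 !subn0 !bin0 !mul1r exprSr.
have j1lt : (j.-1 < eta.+1)%N by rewrite prednK// ltnW.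
rewrite (bigD1 (Ordinal j1lt))//= prednK// eqxx mulr1 big1 ?addr0; last first.
  move=> l /eqP lj; case: eqP; rewrite ?mulr0// => jl; exfalso; apply: lj.
  by apply: val_inj => /=; rewrite jl.
rewrite !IH /=; have [leij|ltji] := leqP i j; last first.
  by rewrite mul0r add0r leqNgt (leq_ltn_trans (leq_pred _) ltji).
have [->|ij] := eqVneq i j.
  rewrite ifF; last by apply/negbTE; rewrite -ltnNge prednK.
  rewrite addr0 subnn !bin0 !mul1r !subn0.
  by rewrite exprSr.
have ltij : (i < j)%N by rewrite ltn_neqAle ij.
have -> : (i <= j.-1)%N by rewrite -ltnS prednK.
have -> : (j - i = (j.-1 - i).+1)%N by rewrite -subSn ?prednK// -ltnS prednK.
move: (j.-1 - i)%N => l; rewrite binS natrD mulrDl.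
rewrite subSS; congr (_ + _).
have [lk|kl] := leqP l.+1 k; last by rewrite bin_small// !mul0r.
by rewrite -mulrA -exprSr subnSK.
Qed.

(** Closed form of e^(tA) for one block: e^(- t nu) times the exponential of t S, with S the
    nilpotent shift. *)
Definition exp_block (t : R) : 'M[R]_eta.+1 := \matrix_(i, j)
  if (i <= j)%N then expR (- (t * nu)) * (t ^+ (j - i) / (j - i)`!%:R) else 0.

Lemma cvg_exp_block (t : R) (i j : 'I_eta.+1) :
  \sum_(0 <= k < n) (k`!%:R)^-1 * (t ^+ k * (A ^+ k) i j) @[n --> \oo] -->
  exp_block t i j.
Proof.
rewrite mxE; under eq_fun do under eq_bigr do rewrite drift_block_expr.
case: ifPn => ij; last first.
  under eq_fun do (rewrite big1; last by move=> *; rewrite !mulr0).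
  exact: cvg_cst.
move: (j - i)%N => l.
pose u k : R := (k`!%:R)^-1 * (t ^+ k * ('C(k, l)%:R * (- nu) ^+ (k - l))).
suff H : series u n @[n --> \oo] --> expR (- (t * nu)) * (t ^+ l / l`!%:R).
  exact: H.
(* The first l terms vanish; after the shift, the quotient of the binomial coefficient by (k + l)!
   is 1 / (l! k!), which leaves the exponential series of - t nu. *)
rewrite -(cvg_shiftn l).
have uE n : series u (n + l)%N =
    t ^+ l / l`!%:R * series (exp_coeff (- (t * nu))) n.
  rewrite addnC /series/= (big_cat_nat (n := l))//= ?leq_addr//.
  rewrite big_nat_cond big1 ?add0r; last first.
    by move=> k /andP[/andP[_ kl] _]; rewrite /u bin_small// !mul0r !mulr0.
  rewrite -{1}[l]add0n big_addn addKn mulr_sumr; apply: eq_bigr => k _.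
  rewrite /u /exp_coeff/= addnK exprD -mulrN exprMn.
  have /(congr1 (fun x : nat => x%:R : R)) := bin_fact (leq_addl k l).
  rewrite addnK natrM => <-; rewrite natrM.
  have f0 x : x`!%:R != 0 :> R by rewrite pnatr_eq0 gtn_eqF// fact_gt0.
  have b0 : 'C(k + l, l)%:R != 0 :> R by rewrite pnatr_eq0 gtn_eqF// bin_gt0 leq_addl.
  by field; rewrite !f0 b0.
under eq_fun do rewrite uE.
by rewrite mulrC; apply: cvgMl_tmp; exact: is_cvg_series_exp_coeff.
Qed.

End drift_exponential.

Lemma block_diag_exp_term (R : comPzRingType) (m n k : nat) (a t : R)
    (A : 'M[R]_m) (B : 'M[R]_n) :
  a *: (t *: block_mx A 0 0 B) ^+ k =
  block_mx (a *: (t ^+ k *: A ^+ k)) 0 0 (a *: (t ^+ k *: B ^+ k)).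
Proof.
by rewrite expr_scalemx block_diag_expr !scale_block_mx !scaler0.
Qed.

Lemma expmx_block_diag (R : realType) (m n : nat) (t : R) (A A' : 'M[R]_m)
    (B B' : 'M[R]_n) :
  (forall i j, \sum_(0 <= k < N) (k`!%:R)^-1 * (t ^+ k * (A ^+ k) i j)
    @[N --> \oo] --> A' i j) ->
  (forall i j, \sum_(0 <= k < N) (k`!%:R)^-1 * (t ^+ k * (B ^+ k) i j)
    @[N --> \oo] --> B' i j) ->
  expmx (t *: block_mx A 0 0 B) = block_mx A' 0 0 B'.
Proof.
move=> cA cB; apply: cvg_lim; first exact: norm_hausdorff.
apply: cvg_mx => i j.
under eq_fun do rewrite /series/= summxE; under eq_fun do under eq_bigr do
  rewrite block_diag_exp_term.
case: (split_ordP i) => i' ->; case: (split_ordP j) => j' ->.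
- rewrite block_mxEul; under eq_fun do under eq_bigr do rewrite block_mxEul !mxE.
  exact: cA.
- rewrite block_mxEur mxE; under eq_fun do under eq_bigr do rewrite block_mxEur mxE.
  by under eq_fun do rewrite big1//; exact: cvg_cst.
- rewrite block_mxEdl mxE; under eq_fun do under eq_bigr do rewrite block_mxEdl mxE.
  by under eq_fun do rewrite big1//; exact: cvg_cst.
- rewrite block_mxEdr; under eq_fun do under eq_bigr do rewrite block_mxEdr !mxE.
  exact: cB.
Qed.

Lemma expmx_drift (R : realType) (eta1 eta2 : nat) (nu1 nu2 t : R) :
  expmx (t *: drift_mx eta1 eta2 nu1 nu2) =
  block_mx (exp_block eta1 nu1 t) 0 0 (exp_block eta2 nu2 t).
Proof. by apply: expmx_block_diag => i j; exact: cvg_exp_block. Qed.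

(** * Contraction of the weighted l1-norm on one block *)

Definition block_weight (R : realType) (eta : nat) (nu : R) (y : 'cV[R]_eta.+1) : R :=
  \sum_(j < eta.+1) j.+1%:R / nu ^+ j * `|y j 0|.

Lemma block_weight_ge0 (R : realType) (eta : nat) (nu : R) (y : 'cV[R]_eta.+1) :
  0 < nu -> 0 <= block_weight nu y.
Proof.
move=> nu0; apply: sumr_ge0 => j _.
by rewrite mulr_ge0// divr_ge0// exprn_ge0// ltW.
Qed.

(** Let s = t nu and w_j = (j + 1) / nu^j. In column j, with d = j - i, w_i t^d <= w_j s^d because i
    + 1 <= j + 1, so the weighted column sum is at most w_j e^(-s) times a partial sum of the series
    of e^s. Partial sums are strictly below e^s. *)
Lemma exp_block_contraction (R : realType) (eta : nat) (nu t : R) :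
  0 < nu -> 0 < t ->
  exists2 r : R, 0 < r < 1 & forall y : 'cV[R]_eta.+1,
    block_weight nu (exp_block eta nu t *m y) <= r * block_weight nu y.
Proof.
move=> nu0 t0; pose s := t * nu; have s0 : 0 < s by rewrite mulr_gt0.
pose S n : R := series (exp_coeff s) n.
have S_nd : nondecreasing_seq S.
  apply/nondecreasing_seqP => n; rewrite /S seriesSr lerDl.
  by apply: exp_coeff_ge0; exact: ltW.
have Slt n : S n < expR s.
  apply: (@lt_le_trans _ _ (S n.+1)).
    by rewrite /S seriesSr ltrDl /exp_coeff/= divr_gt0 ?exprn_gt0// ltr0n fact_gt0.
  by apply: nondecreasing_cvgn_le => //; exact: is_cvg_series_exp_coeff.
have S1 : 0 < S eta.+1.
  rewrite /S /series/= big_nat_recl//= ltr_pwDl//.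
    by rewrite /exp_coeff/= expr0 fact0 divr1.
  by apply: sumr_ge0 => k _; apply: exp_coeff_ge0; exact: ltW.
exists (expR (- s) * S eta.+1).
  rewrite mulr_gt0 ?expR_gt0//= expRN mulrC ltr_pdivrMr ?expR_gt0// mul1r.
  exact: Slt.
move=> y; rewrite /block_weight.
pose w (j : nat) : R := j.+1%:R / nu ^+ j.
have w0 j : 0 <= w j by rewrite divr_ge0// exprn_ge0// ltW.
have E0 i j : 0 <= exp_block eta nu t i j.
  rewrite mxE; case: ifP => // _.
  by rewrite mulr_ge0 ?expR_ge0// divr_ge0// exprn_ge0// ltW.
apply: (@le_trans _ _ (\sum_(i < eta.+1) w i *
    \sum_(j < eta.+1) exp_block eta nu t i j * `|y j 0|)).
  apply: ler_sum => i _; apply: ler_wpM2l; first exact: w0.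
  rewrite mxE (le_trans (ler_norm_sum _ _ _))//.
  by apply: ler_sum => j _; rewrite normrM ger0_norm.
under eq_bigr do rewrite mulr_sumr.
rewrite exchange_big/= mulr_sumr; apply: ler_sum => j _.
under eq_bigr do rewrite mulrA.
rewrite -mulr_suml mulrA ler_wpM2r//.
rewrite -/(w j) -mulrA [S _ * _]mulrC mulrA.
apply: (@le_trans _ _ (\sum_(i < eta.+1 | (i <= j)%N)
    expR (- s) * w j * exp_coeff s (j - i)%N)).
  rewrite [leRHS]big_mkcond/=; apply: ler_sum => i _.
  rewrite mxE; case: ifPn => [ij|_]; last by rewrite mulr0.
  rewrite -/s /exp_coeff/=; set d := (j - i)%N.
  rewrite (_ : w i * _ = expR (- s) / d`!%:R * (w i * t ^+ d)); last by ring.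
  rewrite (_ : _ * w j * _ = expR (- s) / d`!%:R * (w j * s ^+ d)); last by ring.
  rewrite ler_wpM2l ?divr_ge0 ?expR_ge0//.
  have jE : (j = i + d :> nat)%N by rewrite /d subnKC.
  have nuN0 k : nu ^+ k != 0 by rewrite expf_neq0// gt_eqF.
  rewrite /w /s jE exprMn exprD.
  rewrite (_ : (i + d).+1%:R / _ * _ = (i + d).+1%:R / nu ^+ i * t ^+ d).
    apply: ler_wpM2r; first by rewrite exprn_ge0// ltW.
    apply: ler_wpM2r; first by rewrite invr_ge0 exprn_ge0// ltW.
    by rewrite ler_nat ltnS leq_addr.
  by field; rewrite !nuN0.
rewrite -mulr_sumr; apply: ler_wpM2l; first by rewrite mulr_ge0 ?expR_ge0.
have jeta : (j.+1 <= eta.+1)%N by [].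
rewrite (_ : \sum_(_ < _ | _) _ = \sum_(0 <= i < j.+1) exp_coeff s (j - i)%N).
  rewrite big_nat_rev/= add0n.
  rewrite (_ : \sum_(0 <= i < j.+1) _ = S j.+1); first exact: S_nd.
  rewrite /S /series/=; apply: eq_big_nat => i /andP[_ ij].
  by rewrite subSS subKn.
by rewrite (big_nat_widen 0 j.+1 eta.+1)// big_mkord.
Qed.

(** * Controllability of one block through its last coordinate *)

Section controllability.
Context (R : realType) (eta : nat) (nu t : R).
Hypotheses (nu0 : 0 < nu) (t0 : 0 < t).
Local Notation E := (exp_block eta nu t).
Local Notation last_vec := (delta_mx ord_max 0 : 'cV[R]_eta.+1).

(** k steps of length t amount to one step of length k t; in coordinates this is the binomial
    theorem for (k t + t)^L. *)
Lemma exp_block_iter_last k (i : 'I_eta.+1) :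
  iter k (mulmx E) last_vec i 0 =
  expR (- (k%:R * t * nu)) * ((k%:R * t) ^+ (eta - i) / (eta - i)`!%:R).
Proof.
elim: k i => [|k IH] i.
  rewrite /= mxE eqxx andbT !mul0r oppr0 expR0 mul1r expr0n subn_eq0.
  have [->|ilast] := eqVneq i ord_max; first by rewrite leqnn subnn fact0 divr1.
  suff /negbTE -> : ~~ (eta <= i)%N by rewrite mul0r.
  by rewrite -ltnNge ltn_neqAle -ltnS ltn_ord andbT.
rewrite iterS mxE.
pose L := (eta - i)%N.
pose F a : R := expR (- (t * nu)) * (t ^+ a / a`!%:R) *
  (expR (- (k%:R * t * nu)) * ((k%:R * t) ^+ (L - a) / (L - a)`!%:R)).
transitivity (\sum_(m < eta.+1 | (i <= m)%N) F (m - i)%N).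
  rewrite [RHS]big_mkcond/=; apply: eq_bigr => m _.
  rewrite mxE IH; case: ifPn => im; last by rewrite mul0r.
  by rewrite /F /L subnBA// subnK// -ltnS.
rewrite (_ : \sum_(_ < _ | _) _ = \sum_(i <= m < eta.+1) F (m - i)%N); last first.
  by rewrite big_geq_mkord.
rewrite -{1}[i : nat]add0n big_addn big_mkord subSn -1?ltnS// -/L.
under eq_bigr do rewrite addnK.
have f0 x : x`!%:R != 0 :> R by rewrite pnatr_eq0 gtn_eqF// fact_gt0.
have -> : (k.+1%:R * t) ^+ L = (k%:R * t + t) ^+ L.
  by rewrite -natr1 mulrDl mul1r.
rewrite exprDn mulr_suml mulr_sumr; apply: eq_bigr => a _.
have aL : (a <= L)%N by rewrite -ltnS.
have -> : expR (- (k.+1%:R * t * nu)) = expR (- (t * nu)) * expR (- (k%:R * t * nu)).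
  by rewrite -expRD; congr expR; rewrite -natr1; ring.
have /(congr1 (fun x : nat => x%:R : R)) := bin_fact aL; rewrite !natrM => <-.
have b0 : 'C(L, a)%:R != 0 :> R by rewrite pnatr_eq0 gtn_eqF// bin_gt0.
rewrite /F -mulr_natr; field.
by rewrite !f0 b0.
Qed.

(** A row vector [u] annihilating all these vectors gives a polynomial of degree at most eta that
    vanishes at 1, ..., n; as n > eta it is zero, hence u = 0. The vectors therefore span, and [W]
    is a right inverse of their matrix. *)
Lemma exp_block_controllable n : (eta < n)%N ->
  exists W : 'M[R]_(n, eta.+1), forall y : 'cV[R]_eta.+1,
    \sum_(j < n) (W *m y) j 0 *: iter j.+1 (mulmx E) last_vec = y.
Proof.
move=> etan.
pose C := \matrix_(i < eta.+1, j < n) iter j.+1 (mulmx E) last_vec i 0.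
suff /row_freeP[W CW] : row_free C.
  exists W => y; rewrite -[RHS]mul1mx -CW -mulmxA; apply/colP => i.
  rewrite summxE mxE; apply: eq_bigr => j _.
  by rewrite mxE [C i j]mxE mulrC.
apply: inj_row_free => u uC.
(* Coordinate eta - l of the iterates carries the power l of k t, hence the reversed index. *)
pose p := \poly_(l < eta.+1) (u 0 (inord (eta - l)) * (t ^+ l / l`!%:R)).
have p0 : p = 0.
  apply: (@roots_geq_poly_eq0 _ _ [seq k.+1%:R | k <- iota 0 n]).
  - apply/allP => x /mapP[k]; rewrite mem_iota add0n => /= kn ->.
    have /rowP/(_ (Ordinal kn)) := uC; rewrite !mxE => uCk.
    rewrite /root horner_poly -(inj_eq (mulfI (lt0r_neq0 (expR_gt0 (- (k.+1%:R * t * nu)))))).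
    rewrite mulr0 -[X in _ == X]uCk mulr_sumr (reindex_inj rev_ord_inj)/=.
    apply/eqP/eq_bigr => l _; rewrite [C _ _]mxE exp_block_iter_last.
    have le : (l <= eta)%N by rewrite -ltnS.
    rewrite subSS subKn// inord_val exprMn; ring.
  - rewrite map_inj_uniq ?iota_uniq// => a b /eqP.
    by rewrite eqr_nat => /eqP[].
  - by rewrite size_map size_iota (leq_trans (size_poly _ _)).
apply/rowP => i; rewrite mxE.
have := congr1 (fun q : {poly R} => q`_(eta - i)) p0.
have ie : (i <= eta)%N by rewrite -ltnS.
rewrite coef_poly ltnS leq_subr coef0 subKn// inord_val => /eqP.
rewrite mulf_eq0 => /orP[/eqP//|].
by rewrite mulf_eq0 invr_eq0 pnatr_eq0 gtn_eqF ?fact_gt0// orbF expf_eq0 (gt_eqF t0) andbF.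
Qed.

(** Makes the size of the controls of [exp_block_controllable] linear in the weight of the state. *)
Lemma mulmx_weight_bound n (W : 'M[R]_(n, eta.+1)) :
  exists2 K : R, 0 <= K & forall (y : 'cV[R]_eta.+1) j,
    `|(W *m y) j 0| <= K * block_weight nu y.
Proof.
pose w (j : nat) : R := j.+1%:R / nu ^+ j.
have w0 j : 0 < w j by rewrite divr_gt0// exprn_gt0.
pose K j := \sum_(i < eta.+1) `|W j i| / w i.
have K0 j : 0 <= K j.
  by apply: sumr_ge0 => i _; rewrite divr_ge0// ltW.
exists (\sum_j K j); first exact: sumr_ge0.
move=> y j; apply: (@le_trans _ _ (K j * block_weight nu y)); last first.
  rewrite ler_wpM2r ?block_weight_ge0// (bigD1 j)//= lerDl.
  exact: sumr_ge0.
rewrite mxE (le_trans (ler_norm_sum _ _ _))// /K mulr_suml.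
apply: ler_sum => i _; rewrite normrM -mulrA ler_wpM2l//.
rewrite mulrC ler_pdivlMr// mulrC.
rewrite /block_weight (bigD1 i)//= lerDl; apply: sumr_ge0 => l _.
by apply: mulr_ge0 => //; exact: ltW (w0 l).
Qed.

End controllability.

(** * Borel structure on column vectors *)

Section borel_column_vectors.
Context (R : realType) (n : nat).

Lemma measurable_coord (i : 'I_n) :
  measurable_fun setT ((fun x => x i 0) : borel_cV R n -> measurableTypeR R).
Proof.
move=> mD; apply: (measurability _ (RGenOInfty.measurableE R)) => // _ [_ [a ->] <-].
rewrite setTI; apply: sub_sigma_algebra.
apply: (@open_comp _ _ (fun x : 'cV[R]_n => x i 0)); last exact: interval_open.
by move=> x _; exact: coord_continuous.
Qed.

(* Rational boxes form a countable base of the topology. *)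
Lemma measurable_to_borel_cV d (T : measurableType d) (f : T -> borel_cV R n) :
  (forall i, measurable_fun setT (fun t => f t i 0 : measurableTypeR R)) ->
  measurable_fun setT f.
Proof.
move=> mf mD.
apply: (@measurability _ _ T (borel_cV R n) setT f (@open 'cV[R]_n)) => // _ [U oU <-].
rewrite setTI.
pose box (q : 'cV[rat]_n * rat) : set 'cV[R]_n :=
  [set x | forall i, `|x i 0 - ratr (q.1 i 0)| < ratr q.2].
(* Boxes not contained in [U] contribute the empty set, so the union can run over all rational
   boxes. *)
pose F q := if `[< box q `<=` U >] then f @^-1` box q else set0.
have -> : f @^-1` U = \bigcup_q F q.
  apply/seteqP; split => [t /= Uft|t [q _]]; last first.
    by rewrite /F; case: ifPn => // /asboolP; apply.
  have /nbhs_ballP[e /= e0 eU] : nbhs (f t : 'cV[R]_n) U by exact: open_nbhs_nbhs.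
  (* With r < e / 2, any two points of the box differ by less than e in each coordinate. *)
  have [r] := rat_in_itvoo (divr_gt0 e0 (ltr0Sn R 1)).
  rewrite in_itv/= => /andP[r0 re].
  have qP (i : 'I_n) : exists q : rat, `|f t i 0 - ratr q| < ratr r.
    have h : f t i 0 - ratr r < f t i 0 by rewrite ltrBlDr ltrDl.
    have [q] := rat_in_itvoo h; rewrite in_itv/= => /andP[q1 q2]; exists q.
    by rewrite ger0_norm; lra.
  pose q := \col_i sval (cid (qP i)) : 'cV[rat]_n.
  have ftq : box (q, r) (f t).
    by move=> i /=; rewrite mxE; case: cid.
  exists (q, r) => //; rewrite /F; case: ifPn => // /asboolP; apply.
  move=> y yq; apply: eU; split=> // i j; rewrite (ord1 j).
  rewrite /ball/= (_ : f t i 0 - y i 0 =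
    (f t i 0 - ratr (q i 0)) - (y i 0 - ratr (q i 0))); last by ring.
  by rewrite (le_lt_trans (ler_normB _ _))//; have := ftq i; have := yq i => /=; lra.
apply: countable_bigcupT_measurable => [|q]; first exact: countableP.
rewrite /F; case: ifPn => // _.
have -> : f @^-1` box q = \bigcap_(i in [set: 'I_n])
    (fun t => f t i 0) @^-1` [set y : R | `|y - ratr (q.1 i 0)| < ratr q.2].
  by apply/seteqP; split => t /= => [h i _|h i]; exact: h.
apply: fin_bigcap_measurable => // i _.
rewrite -[X in measurable X]setTI; apply: mf => //.
rewrite (_ : [set y | _] = ball (ratr (q.1 i 0) : R) (ratr q.2)).
  exact: measurable_ball.
by apply/seteqP; split => y /=; rewrite /ball/= distrC.
Qed.

End borel_column_vectors.

(** Independence of [Y i] and [xi i] is not a hypothesis but has to be derived. The induction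
    carries a stronger claim: events on [Y i] are independent of all joint events on the noises of
    index at least i. *)
Lemma chain_law d d' d'' (T : measurableType d) (X : measurableType d')
    (Z : measurableType d'') (R : realType) (P : probability T R)
    (gamma : probability Z R) (F : X * Z -> X) (mF : measurable_fun setT F)
    (n : nat) (xi : 'I_n -> T -> Z) (Y : nat -> T -> X) (x0 : X) :
  (forall i, measurable_fun setT (xi i)) ->
  (forall i A, measurable A -> P (xi i @^-1` A) = gamma A) ->
  mutually_independent P xi ->
  (forall w, Y 0 w = x0) ->
  (forall (i : 'I_n) w, Y i.+1 w = F (Y i w, xi i w)) ->
  forall i, (i <= n)%N -> measurable_fun setT (Y i) /\
    forall A, measurable A -> P (Y i @^-1` A) = law gamma mF i x0 A.
Proof.
move=> mxi lawxi ind Y0 YS.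
suff H i : (i <= n)%N -> measurable_fun setT (Y i) /\
    forall (J : {set 'I_n}) (B : 'I_n -> set Z) A,
      (forall j, j \in J -> (i <= j)%N) -> (forall j, measurable (B j)) ->
      measurable A ->
      P (Y i @^-1` A `&` \bigcap_(j in [set` J]) xi j @^-1` B j) =
      (law gamma mF i x0 A * P (\bigcap_(j in [set` J]) xi j @^-1` B j))%E.
  move=> i /H[mY lawY]; split=> // A mA.
  have := lawY finset.set0 (fun=> setT) A _ _ mA.
  rewrite (_ : \bigcap_(j in _) _ = setT); last first.
    by apply/seteqP; split => // t _ j /=; rewrite inE.
  rewrite setIT; have /= -> := @probability_setT _ _ _ P; rewrite mule1.
  by apply=> // j; rewrite inE.
have mC (J : {set 'I_n}) (B : 'I_n -> set Z) : (forall j, measurable (B j)) ->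
    measurable (\bigcap_(j in [set` J]) xi j @^-1` B j).
  move=> mB; apply: fin_bigcap_measurable => // j _.
  by rewrite -[X in measurable X]setTI; exact: mxi.
elim: i => [_|i IH iltn].
  have -> : Y 0 = cst x0 by exact/funext.
  split; first exact: measurable_cst.
  move=> J B A _ mB mA /=; rewrite diracE.
  have [/set_mem x0A|/negP x0A] := boolP (x0 \in A).
    by rewrite mul1e (_ : cst x0 @^-1` A = setT) ?setTI//; apply/seteqP; split.
  rewrite mul0e (_ : cst x0 @^-1` A = set0) ?set0I ?measure0//.
  by apply/seteqP; split => // t /= x0A'; apply: x0A; exact: mem_set.
have [mYi IHi] := IH (ltnW iltn).
pose k := Ordinal iltn.
have YSE : Y i.+1 = F \o (fun w => (Y i w, xi k w)).
  by apply/funext => w; rewrite (YS k).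
have mpair : measurable_fun setT (fun w => (Y i w, xi k w)).
  exact: measurable_fun_pair.
split; first by rewrite YSE; exact: measurableT_comp.
move=> J B A Ji mB mA.
set C := \bigcap_(j in _) _.
have mCC : measurable C by exact: mC.
have kJ : k \notin J by apply/negP => /Ji /=; rewrite ltnn.
have rect (D : set X) (E : set Z) : measurable D -> measurable E ->
    P ((Y i @^-1` D `&` xi k @^-1` E) `&` C) =
    (law gamma mF i x0 D * (gamma E * P C))%E.
  move=> mD mE.
  (* Adding the index [k] to [J] turns the induction hypothesis into a factorization on
     rectangles. *)
  pose B' j := if j == k then E else B j.
  have mB' j : measurable (B' j) by rewrite /B'; case: ifP.
  have CE : \bigcap_(j in [set` J]) xi j @^-1` B' j = C.
    apply: eq_bigcapr => j /= jJ; rewrite /B'; case: eqP => // jk.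
    by move: kJ; rewrite -jk jJ.
  have kCE : \bigcap_(j in [set` (k |: J)%SET]) xi j @^-1` B' j =
      xi k @^-1` E `&` C.
    rewrite -CE; apply/seteqP; split => w /=.
      move=> h; split=> [|j /= jJ]; last by apply: h; rewrite /= !inE jJ orbT.
      by have := h k; rewrite /= /B' eqxx; apply; rewrite !inE eqxx.
    move=> [h1 h2] j /=; rewrite !inE => /orP[/eqP ->|]; last exact: h2.
    by rewrite /B' eqxx.
  have := IHi (k |: J)%SET B' D; rewrite kCE setIA => -> //; last first.
    by move=> j; rewrite !inE => /orP[/eqP -> //|/Ji /ltnW].
  congr (_ * _)%E; rewrite -kCE ind// big_setU1//= -ind// CE.
  by rewrite /B' eqxx lawxi.
(* A null [C] cannot be normalized; both sides are then 0. *)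
have [PC0|PC0] := eqVneq (P C) 0%E.
  rewrite PC0 mule0; apply/eqP; rewrite eq_le measure_ge0 andbT -PC0.
  apply: le_measure; rewrite ?inE//; apply: measurableI => //.
  by rewrite -[X in measurable X]setTI YSE; exact: measurableT_comp.
have PCfin : P C \is a fin_num by exact: fin_num_measure.
pose c := fine (P C).
have c0 : 0 < c by rewrite fine_gt0// lt_def PC0 measure_ge0/= ltey_eq PCfin.
have cV0 : 0 <= c^-1 by rewrite invr_ge0 ltW.
(* Joint law of [Y i] and [xi k] conditioned on [C]: it is the product measure on rectangles, hence
   everywhere. *)
pose m' : {measure set (X * Z)%type -> \bar R} :=
  mscale (NngNum cV0) (pushforward (mrestr P mCC) (fun w => (Y i w, xi k w))).
have m'E D : m' mpair D =
    (c^-1%:E * P ((fun w => (Y i w, xi k w)) @^-1` D `&` C))%E by [].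
have uniq := @product_measure_unique _ _ _ _ _ (law gamma mF i x0) gamma (m' mpair).
have /uniq : forall D E, measurable D -> measurable E ->
    m' mpair (D `*` E) = (law gamma mF i x0 D * gamma E)%E.
  move=> D E mD mE; rewrite m'E.
  rewrite (_ : _ @^-1` (D `*` E) = Y i @^-1` D `&` xi k @^-1` E)//.
  rewrite rect// muleCA; congr (_ * _)%E.
  by rewrite muleCA -(fineK PCfin) -/c -EFinM mulVf ?mule1// gt_eqF.
move/(_ (F @^-1` A)) => mA'.
have mFA : measurable (F @^-1` A) by rewrite -[X in measurable X]setTI; exact: (mF measurableT).
rewrite YSE -(fineK PCfin) -/c.
have -> : law gamma mF i.+1 x0 A = (law gamma mF i x0 \x gamma)%E (F @^-1` A) by [].
rewrite mA'// m'E muleAC -EFinM mulVf ?gt_eqF// mul1e.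
by [].
Qed.

(** * The weight under the linear flow and the kicks; steering to the origin *)

Section weight.
Context (R : realType) (eta1 eta2 : nat) (nu1 nu2 t : R).
Hypotheses (nu10 : 0 < nu1) (nu20 : 0 < nu2) (t0 : 0 < t).
Local Notation kappa := (eta1.+1 + eta2.+1)%N.
Local Notation G := (@Gtilde R eta1 eta2 nu1 nu2).
Local Notation E1 := (exp_block eta1 nu1 t).
Local Notation E2 := (exp_block eta2 nu2 t).
Local Notation E := (block_mx E1 0 0 E2).

Lemma Gtilde_col_mx (u : 'cV[R]_eta1.+1) (v : 'cV[R]_eta2.+1) :
  G (col_mx u v) = block_weight nu1 u + block_weight nu2 v.
Proof.
by congr (_ + _); apply: eq_bigr => j _; rewrite /block1 /block2 ?col_mxEu ?col_mxEd.
Qed.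

Lemma Gtilde_ge0 x : 0 <= G x.
Proof.
by rewrite -[x]vsubmxK Gtilde_col_mx addr_ge0// block_weight_ge0.
Qed.

Lemma block_weightD eta (nu : R) (y z : 'cV[R]_eta.+1) : 0 < nu ->
  block_weight nu (y + z) <= block_weight nu y + block_weight nu z.
Proof.
move=> nu0; rewrite /block_weight -big_split/=; apply: ler_sum => j _.
rewrite -mulrDr mxE; apply: ler_wpM2l; last exact: ler_normD.
by rewrite divr_ge0// exprn_ge0// ltW.
Qed.

Lemma GtildeD x y : G (x + y) <= G x + G y.
Proof.
rewrite -[x]vsubmxK -[y]vsubmxK add_col_mx !Gtilde_col_mx addrACA.
by apply: lerD; exact: block_weightD.
Qed.

Lemma normr_block1_le x : `|block1 x ord0| <= G x.
Proof.
rewrite /Gtilde big_ord_recl/= expr0 divr1 mul1r -addrA lerDl.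
rewrite addr_ge0// ?sumr_ge0// => j _; rewrite mulr_ge0// divr_ge0// exprn_ge0// ltW//.
Qed.

Lemma normr_block2_le x : `|block2 x ord0| <= G x.
Proof.
rewrite /Gtilde [X in _ + X]big_ord_recl/= expr0 divr1 mul1r addrCA lerDl.
rewrite addr_ge0// ?sumr_ge0// => j _; rewrite mulr_ge0// divr_ge0// exprn_ge0// ltW//.
Qed.

Lemma Gtilde_contraction : exists2 gam : R, 0 < gam < 1 &
  forall x, G (E *m x) <= gam * G x.
Proof.
have [r1 /andP[r10 r11] H1] := exp_block_contraction eta1 nu10 t0.
have [r2 /andP[r20 r21] H2] := exp_block_contraction eta2 nu20 t0.
exists (Num.max r1 r2); first by rewrite lt_max r10 gt_max r11.
move=> x; rewrite -[x]vsubmxK mul_block_col !mul0mx addr0 add0r !Gtilde_col_mx.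
rewrite mulrDr; apply: lerD.
  apply: le_trans (H1 _) _; rewrite ler_wpM2r ?block_weight_ge0//.
  by rewrite le_max lexx.
apply: le_trans (H2 _) _; rewrite ler_wpM2r ?block_weight_ge0//.
by rewrite le_max lexx orbT.
Qed.

(* The noise and the drift only enter the last coordinate of each block. *)
Definition kick (w1 w2 : R) : 'cV[R]_kappa :=
  col_mx (w1 *: delta_mx ord_max 0) (w2 *: delta_mx ord_max 0).

Lemma kickD a1 a2 b1 b2 : kick (a1 + b1) (a2 + b2) = kick a1 a2 + kick b1 b2.
Proof. by rewrite /kick add_col_mx -!scalerDl. Qed.

Lemma Gtilde_kick : exists2 k : R, 0 < k & forall w1 w2,
  G (kick w1 w2) <= k * (`|w1| + `|w2|).
Proof.
have bw eta (nu : R) : 0 < nu -> forall w,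
    block_weight nu (w *: delta_mx ord_max 0 : 'cV[R]_eta.+1) =
    eta.+1%:R / nu ^+ eta * `|w|.
  move=> nu0 w; rewrite /block_weight (bigD1 ord_max)//= big1 ?addr0.
    by rewrite !mxE !eqxx mulr1.
  by move=> j /negbTE jm; rewrite !mxE jm mulr0 normr0 mulr0.
exists (eta1.+1%:R / nu1 ^+ eta1 + eta2.+1%:R / nu2 ^+ eta2).
  by rewrite addr_gt0// divr_gt0// exprn_gt0.
move=> w1 w2; rewrite Gtilde_col_mx !bw// mulrDr.
by apply: lerD; rewrite ler_wpM2r// ?lerDl ?lerDr divr_ge0// exprn_ge0// ltW.
Qed.

Lemma iter_mulmx_block k (u : 'cV[R]_eta1.+1) (v : 'cV[R]_eta2.+1) :
  iter k (mulmx E) (col_mx u v) = col_mx (iter k (mulmx E1) u) (iter k (mulmx E2) v).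
Proof.
by elim: k => //= k ->; rewrite mul_block_col !mul0mx addr0 add0r.
Qed.

Lemma iter_mulmxD n (A : 'M[R]_n) k (x y : 'cV[R]_n) :
  iter k (mulmx A) (x + y) = iter k (mulmx A) x + iter k (mulmx A) y.
Proof. by elim: k => //= k ->; rewrite mulmxDr. Qed.

Lemma iter_mulmxZ n (A : 'M[R]_n) k a (x : 'cV[R]_n) :
  iter k (mulmx A) (a *: x) = a *: iter k (mulmx A) x.
Proof. by elim: k => //= k ->; rewrite -scalemxAr. Qed.

Lemma Gtilde_iter k x : G (iter k (mulmx E) x) <= G x.
Proof.
have [gam /andP[g0 g1] H] := Gtilde_contraction.
elim: k => //= k IH; apply: le_trans (H _) _.
by rewrite (le_trans _ IH)// ler_piMl ?Gtilde_ge0// ltW.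
Qed.

(** A pair of kicks acts on both blocks in the same step, so the blocks are steered independently
    within n steps: the controls cancel E^n x, whose weight is at most G x. Since [a j] is
    multiplied by the power j + 1 of [E], controls are numbered backwards in time. *)
Lemma steering n : (eta1 < n)%N -> (eta2 < n)%N ->
  exists2 K : R, 0 <= K & forall x, exists a : nat -> R * R,
    (forall j, `|(a j).1| <= K * G x /\ `|(a j).2| <= K * G x) /\
    iter n (mulmx E) x +
      \sum_(j < n) iter j.+1 (mulmx E) (kick (a j).1 (a j).2) = 0.
Proof.
move=> n1 n2.
have [W1 HW1] := exp_block_controllable nu1 t0 n1.
have [W2 HW2] := exp_block_controllable nu2 t0 n2.
have [K1 K10 HK1] := mulmx_weight_bound nu10 W1.
have [K2 K20 HK2] := mulmx_weight_bound nu20 W2.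
exists (K1 + K2); first exact: addr_ge0.
move=> x; pose y := iter n (mulmx E) x.
have Gy : block_weight nu1 (usubmx y) + block_weight nu2 (dsubmx y) <= G x.
  by rewrite -Gtilde_col_mx vsubmxK; exact: Gtilde_iter.
have b1 := block_weight_ge0 (usubmx y) nu10.
have b2 := block_weight_ge0 (dsubmx y) nu20.
have Gx := Gtilde_ge0 x.
(* The default (0, 0) from index n on makes the bound hold for every natural number j. *)
pose a j : R * R := if insub j is Some i
  then (- (W1 *m usubmx y) i 0, - (W2 *m dsubmx y) i 0) else (0, 0).
exists a; split.
  move=> j; rewrite /a; case: insubP => [i _ _|_] /=; last first.
    by rewrite normr0; split; rewrite mulr_ge0// addr_ge0.
  rewrite !normrN; split.
    apply: le_trans (HK1 _ _) _; apply: ler_pM => //; first by rewrite lerDl.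
    by lra.
  apply: le_trans (HK2 _ _) _; apply: ler_pM => //; first by rewrite lerDr.
  by lra.
have -> : \sum_(j < n) iter j.+1 (mulmx E) (kick (a j).1 (a j).2) = - y.
  pose T1 (j : 'I_n) := iter j.+1 (mulmx E1) (delta_mx ord_max 0 : 'cV[R]_eta1.+1).
  pose T2 (j : 'I_n) := iter j.+1 (mulmx E2) (delta_mx ord_max 0 : 'cV[R]_eta2.+1).
  transitivity (\sum_(j < n) - col_mx ((W1 *m usubmx y) j 0 *: T1 j)
                                      ((W2 *m dsubmx y) j 0 *: T2 j)).
    apply: eq_bigr => j _; rewrite /kick iter_mulmx_block !iter_mulmxZ.
    by rewrite /a valK opp_col_mx -!scaleNr.
  rewrite sumrN -[in RHS](vsubmxK y) -{2}(HW1 (usubmx y)) -{2}(HW2 (dsubmx y)).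
  congr (- _); elim/big_rec3 : _ => [|j u v w _ ->]; first by rewrite col_mx0.
  by rewrite add_col_mx.
by rewrite subrr.
Qed.

End weight.

(** * Chains driven by noisy kicks *)

(** [del] solves gam (1 + del) = (1 + gam) / 2. If b <= del a, then a + b <= (1 + del) a; otherwise
    a <= b / del and the whole sum is charged to b. *)
Lemma exprn_add_le (R : realFieldType) (gam : R) m : 0 < gam < 1 -> (0 < m)%N ->
  exists2 C : R, 0 <= C & forall a b : R, 0 <= a -> 0 <= b ->
    (gam * (a + b)) ^+ m <= (1 + gam) / 2 * a ^+ m + C * b ^+ m.
Proof.
move=> /andP[g0 g1] m0; pose del := (1 - gam) / (2 * gam).
have d0 : 0 < del by rewrite divr_gt0 ?subr_gt0// mulr_gt0.
have gd : gam * (1 + del) = (1 + gam) / 2 by rewrite /del; field; rewrite gt_eqF.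
have dV0 : 0 <= del^-1 by rewrite invr_ge0 ltW.
have C0 : 0 <= (1 + del^-1) ^+ m by rewrite exprn_ge0// addr_ge0.
exists ((1 + del^-1) ^+ m) => // a b a0 b0.
have q0 : 0 <= (1 + gam) / 2 by lra.
have [bda|/ltW dab] := leP b (del * a).
  apply: (@le_trans _ _ (((1 + gam) / 2 * a) ^+ m)).
    rewrite ler_pXn2r ?nnegrE ?mulr_ge0 ?addr_ge0 ?(ltW g0)//.
    by rewrite -gd -mulrA ler_wpM2l ?(ltW g0)//; lra.
  rewrite exprMn -[leLHS]addr0; apply: lerD; last by rewrite mulr_ge0// exprn_ge0.
  rewrite ler_wpM2r ?exprn_ge0// -(prednK m0) exprS ler_piMr// exprn_ile1//; lra.
rewrite -[leLHS]add0r; apply: lerD; first by rewrite mulr_ge0 ?exprn_ge0.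
rewrite -exprMn; apply: lerXn2r; rewrite ?nnegrE ?mulr_ge0 ?addr_ge0 ?(ltW g0)//.
apply: (@le_trans _ _ (a + b)); first by rewrite ler_piMl ?addr_ge0// ltW.
by rewrite mulrDl mul1r [leRHS]addrC lerD2r ler_pdivlMl.
Qed.

(** 1 + a + b is at most three times the largest of 1, a and b, which is taken as [u]. *)
Lemma exprn_add3_le (R : realFieldType) (a b : R) m : 0 <= a -> 0 <= b ->
  (1 + a + b) ^+ m <= 3 ^+ m * (1 + a ^+ m + b ^+ m).
Proof.
move=> a0 b0.
have am : 0 <= a ^+ m by rewrite exprn_ge0.
have bm : 0 <= b ^+ m by rewrite exprn_ge0.
have H (u : R) : 0 <= u -> 1 + a + b <= 3 * u -> u ^+ m <= 1 + a ^+ m + b ^+ m ->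
    (1 + a + b) ^+ m <= 3 ^+ m * (1 + a ^+ m + b ^+ m).
  move=> u0 u3 um; apply: (@le_trans _ _ ((3 * u) ^+ m)).
    by apply: lerXn2r; rewrite ?nnegrE ?addr_ge0 ?mulr_ge0.
  by rewrite exprMn ler_wpM2l ?exprn_ge0.
have [ab|/ltW ba] := leP a b.
  have [b1|/ltW b1] := leP b 1.
    by apply: (H 1) => //; rewrite ?expr1n; lra.
  by apply: (H b) => //; lra.
have [a1|/ltW a1] := leP a 1.
  by apply: (H 1) => //; rewrite ?expr1n; lra.
by apply: (H a) => //; lra.
Qed.

Section noisy_chain.
Context (R : realType) (eta1 eta2 : nat) (nu1 nu2 t : R).
Hypotheses (nu10 : 0 < nu1) (nu20 : 0 < nu2) (t0 : 0 < t).
Local Notation kappa := (eta1.+1 + eta2.+1)%N.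
Local Notation G := (@Gtilde R eta1 eta2 nu1 nu2).
Local Notation E := (block_mx (exp_block eta1 nu1 t) 0 0 (exp_block eta2 nu2 t)).
Local Notation X := (borel_cV R kappa).
Local Notation kick := (@kick R eta1 eta2).
Variables m1 m2 s1 s2 : X -> measurableTypeR R.
Hypotheses (mm1 : measurable_fun setT m1) (mm2 : measurable_fun setT m2).
Hypotheses (ms1 : measurable_fun setT s1) (ms2 : measurable_fun setT s2).
Variable M : R.
Hypotheses (m1M : forall x, `|m1 x| <= M) (m2M : forall x, `|m2 x| <= M).
Hypotheses (s1M : forall x, `|s1 x| <= M) (s2M : forall x, `|s2 x| <= M).
Hypothesis s_ge : forall r : R, exists2 s0 : R, 0 < s0 &
  forall x : 'cV[R]_kappa, G x <= r -> s0 <= `|s1 x| /\ s0 <= `|s2 x|.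

(** The argument below sees the scheme only through measurable bounded coefficients and [s_ge]. The
    noise components are crossed as in the columns of [diffusion]. *)
Definition noisy_step (p : X * noise R) : X :=
  E *m ((p.1 : 'cV[R]_kappa) +
    kick (m1 p.1 + s1 p.1 * p.2.2) (m2 p.1 + s2 p.1 * p.2.1)).

Let gamma : probability (noise R) R :=
  (normal_prob (0 : R) 1 \x normal_prob (0 : R) 1)%E.
Let U2 : probability (noise R) R :=
  (uniform_prob (@ltr01 R) \x uniform_prob (@ltr01 R))%E.

Lemma measurable_mulmx (A : 'M[R]_kappa) d (T : measurableType d) (f : T -> X) :
  measurable_fun setT f -> measurable_fun setT (fun w => A *m (f w : 'cV[R]_kappa) : X).
Proof.
move=> mf; apply: measurable_to_borel_cV => i.
under eq_fun do rewrite mxE.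
apply: measurable_sum => j; apply: measurable_funM; first exact: measurable_cst.
exact: measurableT_comp (measurable_coord j) mf.
Qed.

Lemma measurable_add_kick d (T : measurableType d) (f : T -> X)
    (g1 g2 : T -> measurableTypeR R) :
  measurable_fun setT f -> measurable_fun setT g1 -> measurable_fun setT g2 ->
  measurable_fun setT (fun w => (f w : 'cV[R]_kappa) + kick (g1 w) (g2 w) : X).
Proof.
move=> mf mg1 mg2; apply: measurable_to_borel_cV => i.
under eq_fun do rewrite mxE.
apply: measurable_funD; first exact: measurableT_comp (measurable_coord i) mf.
rewrite /kick; case: (split_ordP i) => j ->.
  under eq_fun do rewrite col_mxEu !mxE.
  by apply: measurable_funM => //; exact: measurable_cst.
under eq_fun do rewrite col_mxEd !mxE.
by apply: measurable_funM => //; exact: measurable_cst.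
Qed.

Lemma measurable_iter_mulmx k d (T : measurableType d) (f : T -> X) :
  measurable_fun setT f ->
  measurable_fun setT (fun w => iter k (mulmx E) (f w : 'cV[R]_kappa) : X).
Proof.
by move=> mf; elim: k => //= k IH; exact: measurable_mulmx.
Qed.

Lemma measurable_noisy_step : measurable_fun setT noisy_step.
Proof.
apply: (@measurable_mulmx E _ _ (fun p : X * noise R => (p.1 : 'cV[R]_kappa) +
    kick (m1 p.1 + s1 p.1 * p.2.2) (m2 p.1 + s2 p.1 * p.2.1))).
have m22 : measurable_fun setT (fun p : X * noise R => p.2.2).
  exact: measurableT_comp measurable_snd measurable_snd.
have m21 : measurable_fun setT (fun p : X * noise R => p.2.1).
  exact: measurableT_comp measurable_fst measurable_snd.
have mfst (f : X -> measurableTypeR R) : measurable_fun setT f ->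
    measurable_fun setT (fun p : X * noise R => f p.1).
  by move=> mf; exact: measurableT_comp mf measurable_fst.
apply: measurable_add_kick; first exact: measurable_fst.
  by apply: measurable_funD; [exact: mfst|apply: measurable_funM; [exact: mfst|]].
by apply: measurable_funD; [exact: mfst|apply: measurable_funM; [exact: mfst|]].
Qed.

Definition clamped_kick (w : noise R) : 'cV[R]_kappa :=
  kick (clamp01 w.1) (clamp01 w.2).

(* The common component of all n-step laws: k independent clamped uniform kicks
   added to y, with no drift and no dependence on the state. *)
Fixpoint smear (k : nat) (h : X -> \bar R) (y : X) : \bar R :=
  if k is k'.+1 then
    (\int[U2]_w smear k' h ((y : 'cV[R]_kappa) + iter k (mulmx E) (clamped_kick w))%R)%E
  else h y.

Let measurable_shift k : measurable_fun setT (fun p : X * noise R =>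
  (p.1 : 'cV[R]_kappa) + iter k (mulmx E) (clamped_kick p.2) : X).
Proof.
have mc1 : measurable_fun setT (fun p : X * noise R => clamp01 p.2.1).
  apply: measurableT_comp; first exact: measurable_clamp01.
  exact: measurableT_comp measurable_fst measurable_snd.
have mc2 : measurable_fun setT (fun p : X * noise R => clamp01 p.2.2).
  apply: measurableT_comp; first exact: measurable_clamp01.
  exact: measurableT_comp measurable_snd measurable_snd.
have mk : measurable_fun setT (fun p : X * noise R =>
    iter k (mulmx E) (clamped_kick p.2) : X).
  apply: measurable_iter_mulmx.
  rewrite (_ : (fun _ => _) = fun p : X * noise R =>
      (0 : 'cV[R]_kappa) + kick (clamp01 p.2.1) (clamp01 p.2.2) : X); last first.
    by apply/funext => p; rewrite add0r.
  by apply: measurable_add_kick => //; exact: measurable_cst.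
apply: measurable_to_borel_cV => i.
under eq_fun do rewrite mxE.
apply: measurable_funD; last exact: measurableT_comp (measurable_coord i) mk.
exact: measurableT_comp (measurable_coord i) measurable_fst.
Qed.

Lemma smear_ge0 k h y : (forall x, 0 <= h x)%E -> (0 <= smear k h y)%E.
Proof. by move=> h0; elim: k y => //= k IH y; exact: integral_ge0. Qed.

Lemma measurable_smear k h : (forall x, 0 <= h x)%E -> measurable_fun setT h ->
  measurable_fun setT (smear k h).
Proof.
move=> h0 mh; elim: k => //= k IH.
apply: (measurable_fun_fubini_tonelli_F (m2 := U2) (fun p : X * noise R =>
  smear k h ((p.1 : 'cV[R]_kappa) + iter k.+1 (mulmx E) (clamped_kick p.2)))).
  exact: measurableT_comp IH (measurable_shift k.+1).
by move=> p; exact: smear_ge0.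
Qed.

Let measurable_smear_shift k h y : (forall x, 0 <= h x)%E -> measurable_fun setT h ->
  measurable_fun setT (fun w : noise R =>
    smear k h ((y : 'cV[R]_kappa) + iter k.+1 (mulmx E) (clamped_kick w))).
Proof.
move=> h0 mh.
have := measurableT_comp (measurable_smear k h0 mh)
  (measurableT_comp (measurable_shift k.+1) (pair1_measurable (y : X))).
exact.
Qed.

Lemma le_smear k h1 h2 y : (forall x, 0 <= h1 x)%E -> (forall x, h1 x <= h2 x)%E ->
  measurable_fun setT h1 -> measurable_fun setT h2 ->
  (smear k h1 y <= smear k h2 y)%E.
Proof.
move=> h10 h12 mh1 mh2; elim: k y => //= k IH y.
have h20 x : (0 <= h2 x)%E by exact: le_trans (h12 x).
apply: ge0_le_integral => //.
- by move=> w _; exact: smear_ge0.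
- exact: measurable_smear_shift.
- exact: measurable_smear_shift.
Qed.

Lemma smearD k h1 h2 y : (forall x, 0 <= h1 x)%E -> (forall x, 0 <= h2 x)%E ->
  measurable_fun setT h1 -> measurable_fun setT h2 ->
  smear k (fun x => h1 x + h2 x)%E y = (smear k h1 y + smear k h2 y)%E.
Proof.
move=> h10 h20 mh1 mh2; elim: k y => //= k IH y.
under eq_integral do rewrite IH.
by rewrite ge0_integralD//; [move=> w _; exact: smear_ge0|
  exact: measurable_smear_shift|move=> w _; exact: smear_ge0|
  exact: measurable_smear_shift].
Qed.

Lemma smear_cst k b y : smear k (fun=> b) y = b.
Proof.
elim: k y => //= k IH y; under eq_integral do rewrite IH.
rewrite -[LHS]/(\int[U2]_w cst b w)%E integral_cst//.
by have /= -> := @probability_setT _ _ _ U2; rewrite mule1.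
Qed.

(* [avg] for extended-valued functions, which needs no integrability. *)
Definition avge (h : X -> \bar R) (x : X) : \bar R :=
  (\int[gamma]_z h (noisy_step (x, z)))%E.

Lemma avge_ge0 k h x : (forall x, 0 <= h x)%E -> (0 <= iter k avge h x)%E.
Proof. by move=> h0; elim: k x => //= k IH x; exact: integral_ge0. Qed.

Lemma measurable_avge k h : (forall x, 0 <= h x)%E -> measurable_fun setT h ->
  measurable_fun setT (iter k avge h).
Proof.
move=> h0 mh; elim: k => //= k IH.
apply: (measurable_fun_fubini_tonelli_F (m2 := gamma) (fun p : X * noise R =>
  iter k avge h (noisy_step p))).
  exact: measurableT_comp IH measurable_noisy_step.
by move=> p; exact: avge_ge0.
Qed.

(** At the price of a factor [d1], the first normal kick is replaced by the control plus a clamped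
    uniform kick. The new state lies in a larger sublevel set for every [w], where the induction
    hypothesis applies. The remaining dynamics is affine, so controls and uniform kicks
    superpose. *)
Lemma iter_avge_ge_smear k (r A : R) : exists2 delta : R, 0 < delta &
  forall (x : 'cV[R]_kappa) (a : nat -> R * R) (h : X -> \bar R),
  G x <= r -> (forall j, `|(a j).1| <= A /\ `|(a j).2| <= A) ->
  (forall x, 0 <= h x)%E -> measurable_fun setT h ->
  (delta%:E * smear k h (iter k (mulmx E) x +
     \sum_(j < k) iter j.+1 (mulmx E) (kick (a j).1 (a j).2))%R <=
   iter k avge h x)%E.
Proof.
have [q q0 Hq] := @Gtilde_kick R eta1 eta2 nu1 nu2 nu10 nu20.
have [gam /andP[g0 g1] Hg] := @Gtilde_contraction R eta1 eta2 nu1 nu2 t nu10 nu20 t0.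
elim: k r => [|k IH] r.
  exists 1 => // x a h xr aA h0 mh.
  by rewrite big_ord0 addr0 mul1e.
have [s0 s00 Hs] := s_ge r.
(* One step raises G by at most q times the size of the kick, each of whose two components is at
   most A + 1 in absolute value. *)
have [dk dk0 Hk] := IH (r + q * (2 * (A + 1))).
have [d1 d10 H1] := @normal2_ge_uniform2 R A M s0 M s00.
exists (d1 * dk) => [|x a h xr aA h0 mh]; first by rewrite mulr_gt0.
have [sx1 sx2] := Hs x xr.
(* The first step uses the control of highest index, the one multiplied by the highest power of
   [E]. *)
have [aA1 aA2] := aA k.
pose H (y : R * R) := iter k avge h (E *m (x + kick y.1 y.2)).
have H0 y : (0 <= H y)%E by exact: avge_ge0.
have mH : measurable_fun setT H.
  have mA : measurable_fun setT (fun y : noise R => E *m (x + kick y.1 y.2) : X).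
    apply: (@measurable_mulmx E _ _ (fun y : noise R => x + kick y.1 y.2 : X)).
    by apply: measurable_add_kick; [exact: measurable_cst|
      exact: measurable_fst|exact: measurable_snd].
  exact: measurableT_comp (measurable_avge k h0 mh) mA.
have step1 := H1 (a k).1 (a k).2 (m1 x) (m2 x) (s1 x) (s2 x) aA1 aA2 (m1M x) (m2M x).
rewrite sx1 sx2 s1M s2M in step1.
have {}step1 := step1 isT isT H mH H0.
rewrite /= -[X in (_ <= X)%E]/(\int[gamma]_z H (m1 x + s1 x * z.2, m2 x + s2 x * z.1)%R)%E.
apply: le_trans step1.
rewrite EFinM -muleA lee_pmul2l ?lte_fin//.
rewrite -ge0_integralZl//; last 3 first.
- exact: measurable_smear_shift.
- by move=> w _; exact: smear_ge0.
- by rewrite lee_fin ltW.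
apply: ge0_le_integral => //.
- by move=> w _; rewrite mule_ge0 ?smear_ge0// lee_fin ltW.
- by apply: measurable_funeM; exact: measurable_smear_shift.
- have mshift (b : R) : measurable_fun setT (fun w : R => b + clamp01 w).
    apply: (@measurable_funD _ _ _ _ (cst b)); first exact: measurable_cst.
    exact: measurable_clamp01.
  apply: measurableT_comp mH _; apply: measurable_fun_pair.
    exact: measurableT_comp (mshift _) measurable_fst.
  exact: measurableT_comp (mshift _) measurable_snd.
move=> w _.
set x' := E *m (x + kick ((a k).1 + clamp01 w.1) ((a k).2 + clamp01 w.2)).
have -> : (iter k.+1 (mulmx E) x + \sum_(j < k.+1) iter j.+1 (mulmx E) (kick (a j).1 (a j).2) +
      iter k.+1 (mulmx E) (clamped_kick w))%R =
    (iter k (mulmx E) x' + \sum_(j < k) iter j.+1 (mulmx E) (kick (a j).1 (a j).2))%R.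
  rewrite /x' -iterSr kickD !iter_mulmxD big_ord_recr/= -!addrA; congr (_ + _).
  by rewrite addrC -!addrA addrC -!addrA.
apply: Hk => //.
rewrite /x' (le_trans (Hg _))//.
apply: (@le_trans _ _ (G (x + kick ((a k).1 + clamp01 w.1) ((a k).2 + clamp01 w.2)))).
  by rewrite ler_piMl ?Gtilde_ge0// ltW.
rewrite (le_trans (GtildeD nu10 nu20 _ _))// lerD// (le_trans (Hq _ _))//.
rewrite ler_wpM2l ?(ltW q0)//.
have c1 := clamp01_itv w.1; have c2 := clamp01_itv w.2.
have h1 : `|(a k).1 + clamp01 w.1| <= A + 1.
  by rewrite (le_trans (ler_normD _ _))// lerD// ger0_norm; case/andP: c1.
have h2 : `|(a k).2 + clamp01 w.2| <= A + 1.
  by rewrite (le_trans (ler_normD _ _))// lerD// ger0_norm; case/andP: c2.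
by lra.
Qed.

(** Every starting point of the sublevel set is steered to 0, so [smear] at 0 bounds both iterates
    from below by one functional, which is additive, monotone and of mass one. *)
Lemma avge_minorization n (r : R) : (eta1 < n)%N -> (eta2 < n)%N ->
  exists2 a : R, 0 < a & forall (b : R) (u v : X -> \bar R) (x y : 'cV[R]_kappa),
    G x <= r -> G y <= r -> measurable_fun setT u -> measurable_fun setT v ->
    (forall z, 0 <= u z)%E -> (forall z, 0 <= v z)%E -> 0 <= b ->
    (forall z, b%:E <= u z + v z)%E ->
    ((a * b)%:E <= iter n avge u x + iter n avge v y)%E.
Proof.
move=> n1 n2.
have [K K0 HK] := @steering R eta1 eta2 nu1 nu2 t nu10 nu20 t0 n n1 n2.
have [a a0 Ha] := iter_avge_ge_smear n r (K * r).
exists a => // b u v x y xr yr mu mv u0 v0 b0 buv.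
have lower (z : 'cV[R]_kappa) h : G z <= r -> (forall x, 0 <= h x)%E ->
    measurable_fun setT h -> (a%:E * smear n h (0%R : 'cV[R]_kappa) <= iter n avge h z)%E.
  move=> zr h0 mh; have [c [cK cE]] := HK z.
  rewrite -cE; apply: Ha => // j; have [c1 c2] := cK j.
  split; [apply: le_trans c1 _|apply: le_trans c2 _]; exact: ler_wpM2l.
apply: le_trans (leeD (lower x u xr u0 mu) (lower y v yr v0 mv)).
rewrite -ge0_muleDr ?smear_ge0// -smearD// EFinM lee_pmul2l ?lte_fin//.
rewrite -[leLHS](smear_cst n b%:E (0%R : 'cV[R]_kappa)); apply: le_smear => //.
exact: emeasurable_funD.
Qed.

Let moment k : exists2 mu : R, 0 <= mu &
  (\int[gamma]_z (`|z.1| ^+ k)%:E = mu%:E /\ \int[gamma]_z (`|z.2| ^+ k)%:E = mu%:E)%E.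
Proof.
have mX : measurable_fun setT (fun z : R => (`|z| ^+ k)%:E).
  by apply/measurable_EFinP; apply: measurable_funX; exact: normr_measurable.
have mX1 : measurable_fun setT (fun z : R * R => (`|z.1| ^+ k)%:E).
  exact: measurableT_comp mX measurable_fst.
have mX2 : measurable_fun setT (fun z : R * R => (`|z.2| ^+ k)%:E).
  exact: measurableT_comp mX measurable_snd.
have I0 : (0 <= \int[normal_prob (0 : R) 1]_z (`|z| ^+ k)%:E)%E.
  by apply: integral_ge0 => z _; rewrite lee_fin.
have Ifin : (\int[normal_prob (0 : R) 1]_z (`|z| ^+ k)%:E)%E \is a fin_num.
  by rewrite ge0_fin_numE//; exact: normal_moment_lty.
exists (fine (\int[normal_prob (0 : R) 1]_z (`|z| ^+ k)%:E)%E); first exact: fine_ge0.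
rewrite fineK//; split.
- rewrite fubini_tonelli1//; apply: eq_integral => z _; rewrite /fubini_F/=.
  rewrite -[LHS]/(\int[normal_prob (0 : R) 1]_y cst (`|z| ^+ k)%:E y)%E.
  by rewrite integral_cst//; have /= -> := @probability_setT _ _ _ (normal_prob (0 : R) 1);
    rewrite mule1.
- rewrite fubini_tonelli2//; apply: eq_integral => z _; rewrite /fubini_G/=.
  rewrite -[LHS]/(\int[normal_prob (0 : R) 1]_y cst (`|z| ^+ k)%:E y)%E.
  by rewrite integral_cst//; have /= -> := @probability_setT _ _ _ (normal_prob (0 : R) 1);
    rewrite mule1.
Qed.

Lemma measurable_Gtilde : measurable_fun setT (G : X -> measurableTypeR R).
Proof.
have mc (i : 'I_kappa) (a : R) : measurable_fun setT (fun x : X => a * `|x i 0|).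
  apply: measurable_funM; first exact: measurable_cst.
  by apply: (measurableT_comp (@normr_measurable _ setT)); exact: measurable_coord.
by apply: measurable_funD; apply: measurable_sum => j; exact: mc.
Qed.

(** Pointwise, G after one step is at most gam (G x + c (1 + |z.1| + |z.2|)); [exprn_add_le]
    separates the two summands at the power m, and the normal moments are finite. *)
Lemma Gtilde_drift m : (0 < m)%N -> exists q K : R, [/\ 0 <= q, q < 1, 0 <= K &
  forall x, (\int[gamma]_z (G (noisy_step (x, z)) ^+ m)%:E <= (q * G x ^+ m + K)%:E)%E].
Proof.
move=> m0.
have [kk kk0 Hk] := @Gtilde_kick R eta1 eta2 nu1 nu2 nu10 nu20.
have [gam gam01 Hg] := @Gtilde_contraction R eta1 eta2 nu1 nu2 t nu10 nu20 t0.
have [g0 g1] := andP gam01.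
have [C C0 HC] := exprn_add_le gam01 m0.
have [mu mu0 [mu1 mu2]] := moment m.
have M0 : 0 <= M by exact: le_trans (normr_ge0 _) (m1M (0 : 'cV[R]_kappa)).
(* A kick component is at most M (1 + |z|) in size, so the two together are at most 2 M (1 + |z.1| +
   |z.2|). *)
have [c c0 cE] : exists2 c : R, 0 <= c & c = 2 * kk * M.
  by exists (2 * kk * M); rewrite // !mulr_ge0// ltW.
pose K0 := C * (c * 3) ^+ m.
have K00 : 0 <= K0 by rewrite mulr_ge0// exprn_ge0// mulr_ge0.
exists ((1 + gam) / 2), (K0 * (1 + mu + mu)); split.
- by lra.
- by lra.
- by rewrite mulr_ge0// !addr_ge0.
move=> x.
have pt z : G (noisy_step (x, z)) ^+ m <=
    (1 + gam) / 2 * G x ^+ m + K0 * (1 + `|z.1| ^+ m + `|z.2| ^+ m).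
  set w1 : R := m1 x + s1 x * z.2; set w2 : R := m2 x + s2 x * z.1.
  have Gw : G (kick w1 w2) <= c * (1 + `|z.1| + `|z.2|).
    apply: le_trans (Hk _ _) _; 
    rewrite (_ : c * _ = kk * (2 * M * (1 + `|z.1| + `|z.2|))); last first.
      by rewrite cE; ring.
    rewrite ler_wpM2l ?(ltW kk0)//.
    have h1 : `|w1| <= M + M * `|z.2|.
      by rewrite (le_trans (ler_normD _ _))// normrM lerD ?ler_wpM2r.
    have h2 : `|w2| <= M + M * `|z.1|.
      by rewrite (le_trans (ler_normD _ _))// normrM lerD ?ler_wpM2r.
    have h3 : 0 <= M * `|z.1| by rewrite mulr_ge0.
    have h4 : 0 <= M * `|z.2| by rewrite mulr_ge0.
    by lra.
  have Y0 : 0 <= c * (1 + `|z.1| + `|z.2|) by rewrite mulr_ge0// !addr_ge0.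
  have Gx0 := @Gtilde_ge0 R eta1 eta2 nu1 nu2 nu10 nu20.
  apply: (@le_trans _ _ ((gam * (G x + c * (1 + `|z.1| + `|z.2|))) ^+ m)).
    have h5 : 0 <= G x + c * (1 + `|z.1| + `|z.2|) by rewrite addr_ge0.
    apply: lerXn2r; rewrite ?nnegrE//; first by rewrite mulr_ge0// ltW.
    apply: le_trans (Hg _) _; rewrite ler_wpM2l ?(ltW g0)//.
    by apply: le_trans (GtildeD nu10 nu20 _ _) _; rewrite lerD2l.
  apply: le_trans (HC _ _ (Gx0 x) Y0) _; rewrite lerD2l.
  rewrite /K0 -mulrA; apply: ler_wpM2l => //.
  rewrite !exprMn -mulrA; apply: ler_wpM2l; first exact: exprn_ge0.
  exact: exprn_add3_le.
have mP1 : measurable_fun setT (fun z : noise R => (`|z.1| ^+ m)%:E).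
  apply/measurable_EFinP; apply: measurable_funX.
  exact: measurableT_comp (@normr_measurable _ setT) measurable_fst.
have mP2 : measurable_fun setT (fun z : noise R => (`|z.2| ^+ m)%:E).
  apply/measurable_EFinP; apply: measurable_funX.
  exact: measurableT_comp (@normr_measurable _ setT) measurable_snd.
have mGF : measurable_fun setT (fun z : noise R => (G (noisy_step (x, z)) ^+ m)%:E).
  apply/measurable_EFinP; apply: measurable_funX.
  apply: measurableT_comp measurable_Gtilde _.
  exact: measurableT_comp measurable_noisy_step (pair1_measurable (x : X)).
have Gx0 y : 0 <= G y by exact: (@Gtilde_ge0 R eta1 eta2 nu1 nu2 nu10 nu20).
have q0 : 0 <= (1 + gam) / 2 by lra.
pose f (z : noise R) : \bar R := (cst ((1 + gam) / 2 * G x ^+ m + K0)%:E z +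
  (K0%:E * (`|z.1| ^+ m)%:E + K0%:E * (`|z.2| ^+ m)%:E))%E.
have fE z : (((1 + gam) / 2 * G x ^+ m + K0 * (1 + `|z.1| ^+ m + `|z.2| ^+ m))%:E = f z)%E.
  by rewrite /f /= -!EFinM -!EFinD; congr EFin; ring.
have mf1 : measurable_fun setT (fun z : noise R => K0%:E * (`|z.1| ^+ m)%:E)%E.
  exact: measurable_funeM.
have mf2 : measurable_fun setT (fun z : noise R => K0%:E * (`|z.2| ^+ m)%:E)%E.
  exact: measurable_funeM.
have mf : measurable_fun setT f.
  by apply: emeasurable_funD; [exact: measurable_cst|exact: emeasurable_funD].
apply: (@le_trans _ _ (\int[gamma]_z f z)%E).
  apply: ge0_le_integral => //.
  - by move=> z _; rewrite lee_fin exprn_ge0.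
  - by move=> z _; rewrite -fE lee_fin.
have a0 : 0 <= (1 + gam) / 2 * G x ^+ m + K0.
  by rewrite addr_ge0// mulr_ge0// exprn_ge0.
rewrite /f ge0_integralD//; last 2 first.
- by move=> z _; rewrite adde_ge0// mule_ge0// lee_fin// exprn_ge0.
- exact: emeasurable_funD.
rewrite ge0_integralD//; last 2 first.
- by move=> z _; rewrite mule_ge0// lee_fin// exprn_ge0.
- by move=> z _; rewrite mule_ge0// lee_fin// exprn_ge0.
rewrite integral_cst//; have /= -> := @probability_setT _ _ _ gamma.
rewrite !ge0_integralZl ?lee_fin//.
rewrite mu1 mu2 mule1 -!EFinM -!EFinD lee_fin.
by rewrite le_eqVlt; apply/orP; left; apply/eqP; ring.
Qed.

End noisy_chain.

(** * The splitting scheme *)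

Lemma Gtilde_gt0 (R : realType) (eta1 eta2 : nat) (nu1 nu2 : R)
    (x : 'cV[R]_(eta1.+1 + eta2.+1)) :
  0 < nu1 -> 0 < nu2 -> x != 0 -> 0 < Gtilde nu1 nu2 x.
Proof.
move=> nu10 nu20; rewrite lt_def Gtilde_ge0// andbT; apply: contra_neq => Gx0.
have t1 (j : 'I_eta1.+1) : 0 <= j.+1%:R / nu1 ^+ j * `|block1 x j|.
  by rewrite mulr_ge0// divr_ge0// exprn_ge0// ltW.
have t2 (j : 'I_eta2.+1) : 0 <= j.+1%:R / nu2 ^+ j * `|block2 x j|.
  by rewrite mulr_ge0// divr_ge0// exprn_ge0// ltW.
move/eqP: Gx0; rewrite paddr_eq0; [|exact: sumr_ge0..].
rewrite !psumr_eq0// => /andP[/allP h1 /allP h2].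
apply/colP => i; rewrite mxE; case: (split_ordP i) => j ->.
  have := h1 j (mem_index_enum _).
  by rewrite /= mulf_eq0 gt_eqF ?divr_gt0 ?exprn_gt0// normr_eq0 => /eqP.
have := h2 j (mem_index_enum _).
by rewrite /= mulf_eq0 gt_eqF ?divr_gt0 ?exprn_gt0// normr_eq0 => /eqP.
Qed.

Section noisy_chain_ergodic.
Context (R : realType) (eta1 eta2 : nat) (nu1 nu2 t : R).
Hypotheses (nu10 : 0 < nu1) (nu20 : 0 < nu2) (t0 : 0 < t).
Local Notation kappa := (eta1.+1 + eta2.+1)%N.
Local Notation G := (@Gtilde R eta1 eta2 nu1 nu2).
Local Notation X := (borel_cV R kappa).
Variables m1 m2 s1 s2 : X -> measurableTypeR R.
Hypotheses (mm1 : measurable_fun setT m1) (mm2 : measurable_fun setT m2).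
Hypotheses (ms1 : measurable_fun setT s1) (ms2 : measurable_fun setT s2).
Variable M : R.
Hypotheses (m1M : forall x, `|m1 x| <= M) (m2M : forall x, `|m2 x| <= M).
Hypotheses (s1M : forall x, `|s1 x| <= M) (s2M : forall x, `|s2 x| <= M).
Hypothesis s_ge : forall r : R, exists2 s0 : R, 0 < s0 &
  forall x : 'cV[R]_kappa, G x <= r -> s0 <= `|s1 x| /\ s0 <= `|s2 x|.
Local Notation F := (noisy_step nu1 nu2 t m1 m2 s1 s2).
Let gamma : probability (noise R) R :=
  (normal_prob (0 : R) 1 \x normal_prob (0 : R) 1)%E.

Let mF : measurable_fun setT F.
Proof. exact: measurable_noisy_step. Qed.

Let Gx0 x : 0 <= G x.
Proof. exact: (@Gtilde_ge0 R eta1 eta2 nu1 nu2 nu10 nu20). Qed.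

Let mGm m : measurable_fun setT (fun x : X => G x ^+ m : measurableTypeR R).
Proof. by apply: measurable_funX; exact: measurable_Gtilde. Qed.

(** Passes from real to extended averages on the weighted class, and from sublevel sets of G^m to
    those of G. The number of steps exceeds both [eta1] and [eta2], as steering requires. *)
Lemma noisy_chain_minorization m (W := fun x : X => 1 + G x ^+ m) q K :
  (0 < m)%N -> 0 <= q -> q < 1 -> 0 <= K ->
  (forall x : X, (\int[gamma]_z (G (F (x, z)) ^+ m)%:E <= (q * G x ^+ m + K)%:E)%E) ->
  minorization (weighted_class W) (fun x : X => G x ^+ m)
    (iter (eta1 + eta2).+1 (avg gamma F)).
Proof.
move=> m0 q0 q1 K0 drift r.
set n := (eta1 + eta2).+1.
have W1 x : 1 <= W x by rewrite lerDl exprn_ge0.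
have mW : measurable_fun setT W.
  by apply: measurable_funD; [exact: measurable_cst|exact: mGm].
have Wc x := drift_weight mF (mGm m) (fun x => exprn_ge0 m (Gx0 x)) q1 K0 drift x.
have [a a0 Ha] := avge_minorization nu10 nu20 t0 mm1 mm2 ms1 ms2 m1M m2M s1M s2M
  s_ge (n := n) (Num.max 1 r) (leq_addr _ _) (leq_addl _ _).
(* Either G x <= 1, or G x <= G x ^+ m <= r because m > 0. *)
have sub x : G x ^+ m <= r -> G x <= Num.max 1 r.
  move=> Gr; rewrite le_max; have [//|/ltW G1] := leP (G x) 1.
  by rewrite (le_trans _ Gr)// -(prednK m0) exprS ler_peMr// exprn_ege1.
have iterE u x : weighted_class W u ->
    (iter n (avg gamma F) u x)%:E = iter n (avge nu1 nu2 t m1 m2 s1 s2) (EFin \o u) x.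
  move=> du; move: (n) => k; elim: k x => //= k IH x.
  rewrite (EFin_avg mF W1 mW Wc); last exact: (iter_avg_weighted mF W1 mW Wc).
  by apply: eq_integral => z _; rewrite IH.
exists a => // b u v x y Vxy du dv u0 v0 b0 buv.
rewrite -lee_fin EFinD !iterE//; apply: Ha => //.
- by apply: sub; apply: le_trans Vxy; rewrite lerDl exprn_ge0.
- by apply: sub; apply: le_trans Vxy; rewrite lerDr exprn_ge0.
- by apply/measurable_EFinP; case: du.
- by apply/measurable_EFinP; case: dv.
Qed.

(** Each weight 1 + G^m could a priori give its own measure; uniqueness identifies all of them with
    the one for m = 1. The base point of the limit functional is fixed at 0, so the constants are
    uniform in [x0]. *)
Theorem noisy_chain_ergodic : exists mu : probability X R,
  [/\ forall A, measurable A -> (\int[mu]_x gamma [set z | A (F (x, z))])%E = mu A,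
      forall nu : probability X R,
        (forall A, measurable A -> (\int[nu]_x gamma [set z | A (F (x, z))])%E = nu A) ->
        forall A, measurable A -> nu A = mu A &
      forall m, (0 < m)%N -> exists2 C : R, 0 <= C & exists2 rho : R, 0 < rho < 1 &
        forall g : X -> R, measurable_fun setT g -> (forall x, `|g x| <= 1 + G x ^+ m) ->
        forall (mF : measurable_fun setT F) i x0,
        (law gamma mF i x0).-integrable setT (EFin \o g) /\
        (`|\int[law gamma mF i x0]_y (g y)%:E - \int[mu]_y (g y)%:E| <=
          (C * rho ^+ i * (1 + G x0 ^+ m))%:E)%E].
Proof.
have ex m : (0 < m)%N -> exists mu : probability X R,
  [/\ forall A, measurable A -> (\int[mu]_x gamma [set z | A (F (x, z))])%E = mu A,
      forall nu : probability X R,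
        (forall A, measurable A -> (\int[nu]_x gamma [set z | A (F (x, z))])%E = nu A) ->
        forall A, measurable A -> nu A = mu A &
      exists2 C : R, 0 <= C & exists2 rho : R, 0 < rho < 1 &
        forall g : X -> R, measurable_fun setT g -> (forall x, `|g x| <= 1 + G x ^+ m) ->
        forall (mF : measurable_fun setT F) i x0,
        (law gamma mF i x0).-integrable setT (EFin \o g) /\
        (`|\int[law gamma mF i x0]_y (g y)%:E - \int[mu]_y (g y)%:E| <=
          (C * rho ^+ i * (1 + G x0 ^+ m))%:E)%E].
  move=> m0.
  have [q [K [q0 q1 K0 drift]]] :=
    Gtilde_drift nu10 nu20 t0 mm1 mm2 ms1 ms2 m1M m2M s1M s2M m0.
  have Vm0 x : 0 <= G x ^+ m by rewrite exprn_ge0.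
  have [mu [inv uniq [C C0 [rho rho01 rate]]]] :=
    harris_theorem mF (0 : 'cV[R]_kappa) (mGm m) Vm0 q0 q1 K0 drift (ltn0Sn _)
      (noisy_chain_minorization m0 q0 q1 K0 drift).
  exists mu; split=> //; exists C => //; exists rho => // g mg gW mF' i x0.
  have W1 x : 1 <= 1 + G x ^+ m by rewrite lerDl.
  have mW : measurable_fun setT (fun x : X => 1 + G x ^+ m : measurableTypeR R).
    by apply: measurable_funD; [exact: measurable_cst|exact: mGm].
  have Wg : weighted_class (fun x : X => 1 + G x ^+ m) g.
    by split=> //; exists 1 => x; rewrite mul1r.
  have Wc := drift_weight mF (mGm m) Vm0 q1 K0 drift.
  split; first exact: weighted_class_integrable (law_integrable mF' W1 mW Wc i x0) Wg.
  by rewrite (integral_law mF' W1 mW Wc)//; exact: rate.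
have [mu [inv uniq _]] := ex 1%N isT.
exists mu; split=> // m m0.
have [mu' [inv' _ [C C0 [rho rho01 rate]]]] := ex m m0.
exists C => //; exists rho => // g mg gW mF' i x0.
suff -> : (\int[mu]_y (g y)%:E = \int[mu']_y (g y)%:E)%E by exact: rate.
by apply: eq_measure_integral => A mA _; apply/esym; exact: uniq.
Qed.

End noisy_chain_ergodic.

Lemma integral_chain d (T : measurableType d) d' (X : measurableType d')
    (R : realType) (P : probability T R) (Y : T -> X) (L : probability X R)
    (g : X -> R) :
  measurable_fun setT Y -> (forall A, measurable A -> P (Y @^-1` A) = L A) ->
  measurable_fun setT g -> L.-integrable setT (EFin \o g) ->
  ('E_P[fun w => g (Y w)] = \int[L]_x (g x)%:E)%E.
Proof.
move=> mY lawY mg ig; rewrite unlock.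
have meg : measurable_fun setT (EFin \o g) by exact/measurable_EFinP.
have eqL f : (\int[L]_x f x = \int[pushforward P Y]_x f x)%E.
  by apply: eq_measure_integral => A mA _; exact/esym/lawY.
have iY : P.-integrable (Y @^-1` setT) ((EFin \o g) \o Y).
  rewrite preimage_setT; apply/integrableP; split; first exact: measurableT_comp.
  have /integrableP[_] := ig; rewrite eqL.
  by rewrite (@ge0_integral_pushforward _ _ _ _ _ Y mY P)//; exact: measurableT_comp.
by rewrite eqL (@integral_pushforward _ _ _ _ _ Y mY P _ _ meg iY)// preimage_setT.
Qed.

Section splitting.
Context (R : realType) (eta1 eta2 : nat) (nu1 nu2 c1 c2 p1 p2 : R)
  (f1 f2 : R -> R) (N : nat) (Delta : R).
Hypotheses (nu10 : 0 < nu1) (nu20 : 0 < nu2).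
Hypotheses (hc1 : c1 = -1 \/ c1 = 1) (hc2 : c2 = -1 \/ c2 = 1).
Hypotheses (N0 : (0 < N)%N) (p10 : 0 < p1) (p20 : 0 < p2) (Delta0 : 0 < Delta).
Hypotheses (hf1 : assumption_A f1) (hf2 : assumption_A f2).
Local Notation kappa := (eta1.+1 + eta2.+1)%N.
Local Notation X := (borel_cV R kappa).
Local Notation G := (@Gtilde R eta1 eta2 nu1 nu2).

Definition kick_mean (c : R) (f : R -> R) (y : R) : R := Delta * (c * f y).
Definition kick_scale (c p : R) (f : R -> R) (y : R) : R :=
  Num.sqrt Delta / Num.sqrt N%:R * (c / Num.sqrt p * Num.sqrt (f y)).

Lemma splitting_stepE (x : 'cV[R]_kappa) (z : noise R) :
  splitting_step nu1 nu2 c1 c2 p1 p2 f1 f2 N Delta x (noise_vec z) =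
  noisy_step nu1 nu2 Delta
    (fun x => kick_mean c1 f2 (block2 x ord0)) (fun x => kick_mean c2 f1 (block1 x ord0))
    (fun x => kick_scale c1 p2 f2 (block2 x ord0))
    (fun x => kick_scale c2 p1 f1 (block1 x ord0)) (x, z).
Proof.
rewrite /splitting_step /noisy_step expmx_drift/= -addrA; congr (_ *m (_ + _)).
apply/colP => i; rewrite !mxE !big_ord_recl big_ord0 addr0.
rewrite /coupling /diffusion /kick /kick_mean /kick_scale.
have e : (ord0 == 0 :> 'I_2) * (ord0 == 1 :> 'I_2 = false) *
    (lift ord0 ord0 == 0 :> 'I_2 = false) * (lift ord0 ord0 == 1 :> 'I_2) by [].
case: (split_ordP i) => j ->; rewrite !(col_mxEu, col_mxEd) !mxE !e ?eqxx !(andbT, andbF).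
  by have [_|_] := eqVneq j ord_max => /=; ring.
by have [_|_] := eqVneq j ord_max => /=; ring.
Qed.

Lemma norm_sign (c : R) : c = -1 \/ c = 1 -> `|c| = 1.
Proof. by case=> ->; rewrite ?normrN normr1. Qed.

Lemma kick_mean_le c f : c = -1 \/ c = 1 -> assumption_A f ->
  exists M : R, forall y, `|kick_mean c f y| <= M.
Proof.
move=> hc [_ _ [fm fmP]]; exists (Delta * fm) => y.
have /andP[f0 fle] := fmP y.
by rewrite /kick_mean !normrM (norm_sign hc) mul1r !gtr0_norm// ler_wpM2l// ltW.
Qed.

Lemma kick_scaleE c p f y : c = -1 \/ c = 1 ->
  `|kick_scale c p f y| = Num.sqrt Delta / Num.sqrt N%:R / Num.sqrt p * Num.sqrt (f y).
Proof.
move=> hc; rewrite /kick_scale !normrM (norm_sign hc) mul1r !normfV.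
by rewrite !(ger0_norm (sqrtr_ge0 _)) !mulrA.
Qed.

Lemma kick_scale_le c p f : c = -1 \/ c = 1 -> assumption_A f ->
  exists M : R, forall y, `|kick_scale c p f y| <= M.
Proof.
move=> hc [_ _ [fm fmP]].
exists (Num.sqrt Delta / Num.sqrt N%:R / Num.sqrt p * Num.sqrt fm) => y.
have /andP[f0 fle] := fmP y.
rewrite kick_scaleE// ler_wpM2l ?ler_wsqrtr//.
Qed.

(** By monotonicity f y >= f (- r) > 0 as soon as y >= - r. The bound depends on [r] because f may
    tend to 0 at minus infinity. *)
Lemma kick_scale_ge c p f (r : R) : c = -1 \/ c = 1 -> 0 < p -> assumption_A f ->
  exists2 s0 : R, 0 < s0 & forall y, `|y| <= r -> s0 <= `|kick_scale c p f y|.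
Proof.
move=> hc p0 [_ fmono [fm fmP]].
have /andP[fr0 _] := fmP (- r).
exists (Num.sqrt Delta / Num.sqrt N%:R / Num.sqrt p * Num.sqrt (f (- r))).
  by rewrite mulr_gt0 ?divr_gt0 ?sqrtr_gt0// ltr0n.
move=> y; rewrite ler_norml => /andP[ry _].
rewrite kick_scaleE// ler_wpM2l ?ler_wsqrtr ?fmono//.
Qed.

Lemma measurable_assumption_A f : assumption_A f -> measurable_fun [set: R] f.
Proof. by case=> _ fmono _; exact: nondecreasing_measurable. Qed.

Lemma measurable_kick_mean c f : assumption_A f -> measurable_fun [set: R] (kick_mean c f).
Proof.
move=> hf; apply: measurable_funM; first exact: measurable_cst.
by apply: measurable_funM; [exact: measurable_cst|exact: measurable_assumption_A].
Qed.

Lemma measurable_kick_scale c p f : assumption_A f ->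
  measurable_fun [set: R] (kick_scale c p f).
Proof.
move=> hf; apply: measurable_funM; first exact: measurable_cst.
apply: measurable_funM; first exact: measurable_cst.
apply: (@measurableT_comp _ _ _ _ _ _ (@Num.sqrt R)); last exact: measurable_assumption_A.
by apply: continuous_measurable_fun; exact: sqrt_continuous.
Qed.

Let Phi := @splitting_step R eta1 eta2 nu1 nu2 c1 c2 p1 p2 f1 f2 N Delta.

Theorem splitting_ergodic :
  measurable_fun setT ((fun p => Phi p.1 (noise_vec p.2)) : X * noise R -> X) /\
  exists mu : probability X R,
  [/\ invariant_measure Phi mu,
      (forall nu : probability X R, invariant_measure Phi nu ->
        forall A, measurable A -> nu A = mu A) &
      forall m, (0 < m)%N -> exists2 C : R, 0 <= C & exists2 rho : R, 0 < rho < 1 &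
        forall g : X -> R, measurable_fun setT g -> (forall x, `|g x| <= 1 + G x ^+ m) ->
        forall (mF : measurable_fun setT
          ((fun p => Phi p.1 (noise_vec p.2)) : X * noise R -> X)) i x0,
        (law (normal_prob (0 : R) 1 \x normal_prob (0 : R) 1)%E mF i x0).-integrable
          setT (EFin \o g) /\
        (`|\int[law (normal_prob (0 : R) 1 \x normal_prob (0 : R) 1)%E mF i x0]_y (g y)%:E
            - \int[mu]_y (g y)%:E| <= (C * rho ^+ i * (1 + G x0 ^+ m))%:E)%E].
Proof.
have mb1 : measurable_fun setT (fun x : X => block1 x ord0 : measurableTypeR R).
  exact: measurable_coord.
have mb2 : measurable_fun setT (fun x : X => block2 x ord0 : measurableTypeR R).
  exact: measurable_coord.
have [M1 HM1] := kick_mean_le hc1 hf2.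
have [M2 HM2] := kick_mean_le hc2 hf1.
have [S1 HS1] := kick_scale_le p2 hc1 hf2.
have [S2 HS2] := kick_scale_le p1 hc2 hf1.
have M10 : 0 <= M1 := le_trans (normr_ge0 _) (HM1 0).
have M20 : 0 <= M2 := le_trans (normr_ge0 _) (HM2 0).
have S10 : 0 <= S1 := le_trans (normr_ge0 _) (HS1 0).
have S20 : 0 <= S2 := le_trans (normr_ge0 _) (HS2 0).
pose M := M1 + M2 + S1 + S2.
pose m1 (x : X) : measurableTypeR R := kick_mean c1 f2 (block2 x ord0).
pose m2 (x : X) : measurableTypeR R := kick_mean c2 f1 (block1 x ord0).
pose s1 (x : X) : measurableTypeR R := kick_scale c1 p2 f2 (block2 x ord0).
pose s2 (x : X) : measurableTypeR R := kick_scale c2 p1 f1 (block1 x ord0).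
have mm1 : measurable_fun setT m1 := measurableT_comp (measurable_kick_mean c1 hf2) mb2.
have mm2 : measurable_fun setT m2 := measurableT_comp (measurable_kick_mean c2 hf1) mb1.
have ms1 : measurable_fun setT s1 := measurableT_comp (measurable_kick_scale c1 p2 hf2) mb2.
have ms2 : measurable_fun setT s2 := measurableT_comp (measurable_kick_scale c2 p1 hf1) mb1.
have m1M x : `|m1 x| <= M by rewrite (le_trans (HM1 _))// /M; lra.
have m2M x : `|m2 x| <= M by rewrite (le_trans (HM2 _))// /M; lra.
have s1M x : `|s1 x| <= M by rewrite (le_trans (HS1 _))// /M; lra.
have s2M x : `|s2 x| <= M by rewrite (le_trans (HS2 _))// /M; lra.
have s_ge (r : R) : exists2 s0 : R, 0 < s0 &
    forall x : 'cV[R]_kappa, G x <= r -> s0 <= `|s1 x| /\ s0 <= `|s2 x|.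
  have [a a0 Ha] := kick_scale_ge r hc1 p20 hf2.
  have [b b0 Hb] := kick_scale_ge r hc2 p10 hf1.
  exists (Num.min a b); first by rewrite lt_min a0.
  move=> x xr; rewrite !ge_min; split.
    by rewrite (Ha _ (le_trans (normr_block2_le nu10 nu20 x) xr)).
  by rewrite (Hb _ (le_trans (normr_block1_le nu10 nu20 x) xr)) orbT.
have FE : noisy_step nu1 nu2 Delta m1 m2 s1 s2 =
    (fun p => Phi p.1 (noise_vec p.2)) :> (X * noise R -> X).
  by apply/funext => -[x z]; rewrite /= /Phi splitting_stepE.
have mF := measurable_noisy_step nu1 nu2 Delta mm1 mm2 ms1 ms2.
have := noisy_chain_ergodic nu10 nu20 Delta0 mm1 mm2 ms1 ms2 m1M m2M s1M s2M s_ge.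
by rewrite FE in mF *; move=> ?; split.
Qed.

End splitting.

Theorem theorem8 (R : realType) (eta1 eta2 : nat) (nu1 nu2 c1 c2 p1 p2 : R)
    (f1 f2 : R -> R) (N : nat) (Delta : R)
    (heta1 : (1 <= eta1)%N) (heta2 : (1 <= eta2)%N)
    (hnu1 : 0 < nu1) (hnu2 : 0 < nu2)
    (hc1 : c1 = -1 \/ c1 = 1) (hc2 : c2 = -1 \/ c2 = 1)
    (hN : (1 <= N)%N)
    (hp1 : 0 < p1) (hp2 : 0 < p2) (hp : p1 + p2 = 1)
    (hDelta : 0 < Delta)
    (hf1 : assumption_A f1) (hf2 : assumption_A f2) :
  let Phi := @splitting_step R eta1 eta2 nu1 nu2 c1 c2 p1 p2 f1 f2 N Delta in
  let G := @Gtilde R eta1 eta2 nu1 nu2 in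
  exists mu : probability (borel_cV R (eta1.+1 + eta2.+1)) R,
    [/\ invariant_measure Phi mu,
        (forall mu' : probability (borel_cV R (eta1.+1 + eta2.+1)) R,
           invariant_measure Phi mu' ->
           forall A, measurable A -> mu' A = mu A) &
        forall m : nat, (1 <= m)%N ->
          exists lambda : R,
            [/\ 0 < lambda,
                (forall x0, x0 != 0 -> exists C : R, 0 < C /\
                   exponential_bound Phi Delta mu (fun x => G x ^+ m) x0
                     (C * G x0 ^+ m) lambda) &
                (exists C : R, 0 < C /\ forall x0,
                   exponential_bound Phi Delta mu (fun x => G x ^+ m) x0
                     (C * (1 + G x0 ^+ m)) lambda)]].
Proof.
move=> Phi G.
have [mF [mu [inv uniq rate]]] := splitting_ergodic eta1 eta2 hnu1 hnu2 hc1 hc2 hN hp1 hp2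
  hDelta hf1 hf2.
exists mu; split=> // m m1.
have [C C0 [rho /andP[rho0 rho1] {}rate]] := rate m m1.
(* Chosen so that rho^i = e^(- lambda t_i) with t_i = i Delta; it depends on [m] through [rho], but
   not on the starting point. *)
pose lambda := - ln rho / Delta.
(* [C] may be 0 while the constant must be positive, hence [C + 1]. *)
have bound x0 : exponential_bound Phi Delta mu (fun x => G x ^+ m) x0
    ((C + 1) * (1 + G x0 ^+ m)) lambda.
  move=> imax d T P xi X [mxi lawxi ind] [X0 XS] g mg gV i iimax.
  have gW x : `|g x| <= 1 + G x ^+ m by rewrite (le_trans (gV x))// lerDr.
  have [mX lawX] := chain_law mF mxi lawxi ind X0 XS iimax.
  have [ig le] := rate g mg gW mF i x0.
  rewrite (integral_chain (mX : measurable_fun setT (X i : T -> borel_cV R _)) lawX mg ig).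
  apply: le_trans le _; rewrite lee_fin [leRHS]mulrAC ler_wpM2r ?addr_ge0 ?exprn_ge0//.
    exact: Gtilde_ge0.
  have -> : rho ^+ i = expR (- lambda * (i%:R * Delta)).
    rewrite -{1}(lnK (x := rho)) ?posrE// -expRM_natl; congr expR.
    by rewrite /lambda; field; rewrite gt_eqF.
  by rewrite ler_wpM2r ?expR_ge0// lerDl.
have C10 : 0 < C + 1 by rewrite ltr_wpDl.
exists lambda; split.
- by rewrite divr_gt0// oppr_gt0 ln_lt0// rho0.
- move=> x0 x00; have Gx0 := exprn_gt0 m (Gtilde_gt0 hnu1 hnu2 x00).
  (* Away from 0 the factor (1 + G^m) / G^m can go into the constant, which thereby depends on
     [x0]. *)
  exists ((C + 1) * (1 + G x0 ^+ m) / G x0 ^+ m); split.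
    by rewrite divr_gt0// mulr_gt0// ltr_wpDr// ltW.
  by rewrite divfK ?gt_eqF.
- by exists (C + 1).
Qed.
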